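(* Let $d\geq 2$ and $k\geq d+1$ be integers, and let $C_d(k)^*$ be the dual of the $d$-dimensional cyclic polytope on $k$ vertices. (1) If $d\leq 3$, or ($d=4$ and $k=7$), or $k\leq d+2$, then $C_d(k)^*$ is inscribable. (2) If $k\geq d+4\geq 8$, then $C_d(k)^*$ is not inscribable.
   Context: The cyclic polytope $C_d(k)$ is the combinatorial type of the convex hull of $k$ distinct points on the moment curve $t\mapsto (t,t^2,\dots,t^d)$ in $\mathbb{R}^d$; $C_d(k)^*$ is its dual, i.e. the combinatorial type whose face lattice is the face lattice of $C_d(k)$ with reversed order. A $d$-polytope is inscribed if all its vertices lie on a common $(d-1)$-sphere in $\mathbb{R}^d$. A polytope (or combinatorial type) is inscribable if it is combinatorially equivalent to an inscribed polytope. *)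

(* Defs.v *)
From HB Require Import structures.
From mathcomp Require Import all_boot all_order all_algebra.
From mathcomp Require Import boolp classical_sets cardinality reals convex.

Set Implicit Arguments.
Unset Strict Implicit.
Unset Printing Implicit Defensive.

Import Order.TTheory GRing.Theory Num.Theory.
Local Open Scope classical_set_scope.
Local Open Scope ring_scope.

Section Polytopes.
Variables (R : realType) (d : nat).
Implicit Types (A P F : set 'rV[R]_d) (u v x c : 'rV[R]_d).

(* The Euclidean inner product; the norm that mathcomp-analysis puts on
   'rV[R]_d is the sup norm, hence is not used for spheres. *)
Definition dotv u v : R := \sum_(i < d) u 0 i * v 0 i.

Definition conv_hull A : set 'rV[R]_d := smallest (@convex_set R 'rV[R]_d) A.

Definition affine_hull A : set 'rV[R]_d :=
  [set x | exists (n : nat) (p : 'I_n -> 'rV[R]_d) (w : 'I_n -> R),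
     [/\ forall i, A (p i), \sum_i w i = 1 & x = \sum_i w i *: p i]].

Definition polytope P : Prop := exists2 A, finite_set A & P = conv_hull A.

(* A d-polytope in R^d: its affine hull has dimension d. *)
Definition full_polytope P : Prop := polytope P /\ affine_hull P = setT.

(* The choice u = 0 yields the two improper faces: P (with b = 0) and the
   empty set (with b = 1). *)
Definition face P F : Prop :=
  exists (u : 'rV[R]_d) (b : R),
    (forall x, P x -> dotv u x <= b) /\ F = P `&` [set x | dotv u x = b].

Definition vertex P v : Prop := face P [set v].

Definition sphere c (r : R) : set 'rV[R]_d :=
  [set x | dotv (x - c) (x - c) = r ^+ 2].

Definition inscribed P : Prop :=
  full_polytope P /\
  exists (c : 'rV[R]_d) (r : R), 0 < r /\ vertex P `<=` sphere c r.

Record face_lattice P : Type :=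
  Face { face_set :> set 'rV[R]_d; faceP : `[< face P face_set >] }.

Definition moment_curve (t : R) : 'rV[R]_d := \row_(i < d) t ^+ i.+1.

Definition cyclic_polytope (k : nat) P : Prop :=
  exists2 t : 'I_k -> R, injective t & P = conv_hull (range (moment_curve \o t)).

End Polytopes.

(* Order.le on set T is inclusion, which the face lattice inherits. *)
HB.instance Definition _ (R : realType) (d : nat) (P : set 'rV[R]_d) :=
  [isSub for @face_set R d P].
HB.instance Definition _ (R : realType) (d : nat) (P : set 'rV[R]_d) :=
  [Choice of face_lattice P by <:].
HB.instance Definition _ (R : realType) (d : nat) (P : set 'rV[R]_d) :=
  [SubChoice_isSubPOrder of face_lattice P by <: with set_display].

Definition poset_isomorphic (disp1 disp2 : Order.disp_t)
    (L1 : porderType disp1) (L2 : porderType disp2) : Prop :=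
  exists2 f : L1 -> L2, bijective f & {mono f : x y / (x <= y)%O}.

(* A combinatorial type of d-polytopes is given by its face lattice L, a poset
   that matters only up to isomorphism. *)
Definition inscribable (R : realType) (d : nat) (disp : Order.disp_t)
    (L : porderType disp) : Prop :=
  exists2 Q : set 'rV[R]_d, inscribed Q & poset_isomorphic (face_lattice Q) L.

Definition dual_type (R : realType) (d : nat) (P : set 'rV[R]_d) :
  porderType _ := ((face_lattice P)^d)%type.

(* Main.v *)
(* Both halves rest on a combinatorial description of the cyclic polytope: a
   proper face of C_d(k) is a subset of a d-set S of labels satisfying Gale's
   evenness condition, since a supporting hyperplane is a polynomial of degree at
   most d that is nonnegative at the nodes.

   For (1), points q_S on a sphere, one for each Gale set S, realize C_d(k)^* as
   soon as there are k half-spaces such that q_S lies in all of them and exactly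
   on the boundary of those labelled by S: the edges at q_S are dual to the d
   normals there, so a functional maximal at q_S is a nonnegative combination of
   these normals. Explicit coordinates do the rest: polygons on a circle for
   d = 2, for d = 3 two polygons sharing an edge joined by isosceles trapezoids,
   0/1 points of products of simplices for k <= d + 2, and 14 points for C_4(7)^*.

   For (2), let v be the vertex of C_4(m)^* on the facets i, i+1, j, j+1, with i
   and j far apart, and invert at v. The circumscribed circles of the polygon
   i, i+1 and of the polygon j, j+1 become two lines, which carry two opposite
   edges of a tetrahedron formed by the neighbours of v. The quadrilaterals at v
   become the other four edges, and the powers of the vertices of the
   tetrahedron express the squares of these four edge lengths by the positions
   on the two lines of the points
   {i-2,i-1,i,i+1}, {i-1,i,i+1,i+2}, {i,i+1,i+2,i+3} and of their analogues for j.
   These lengths force the middle points of the two triples, which are distinct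
   vertices, to be at distance 0. *)

Require Import Defs.
From mathcomp Require Import all_boot all_order all_algebra.
From mathcomp Require Import boolp classical_sets reals.
From mathcomp Require Import cardinality convex unstable interval_inference.
From mathcomp Require Import zify ring lra.

Set Implicit Arguments.
Unset Strict Implicit.
Unset Printing Implicit Defensive.

Import Order.TTheory GRing.Theory Num.Theory.
Local Open Scope ring_scope.

(** * Faces of the convex hull of finitely many points *)

Section DotProduct.
Variables (R : realType) (d : nat).
Implicit Types u v x : 'rV[R]_d.

Lemma dotvC u v : dotv u v = dotv v u.
Proof. by apply: eq_bigr => i _; rewrite mulrC. Qed.

Lemma dotvDr u v x : dotv u (v + x) = dotv u v + dotv u x.
Proof. by rewrite -big_split; apply: eq_bigr => i _; rewrite mxE mulrDr. Qed.

Lemma dotvZr u a v : dotv u (a *: v) = a * dotv u v.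
Proof. by rewrite mulr_sumr; apply: eq_bigr => i _; rewrite mxE mulrCA. Qed.

Lemma dotvDl u v x : dotv (u + v) x = dotv u x + dotv v x.
Proof. by rewrite dotvC dotvDr !(dotvC x). Qed.

Lemma dotvZl a u v : dotv (a *: u) v = a * dotv u v.
Proof. by rewrite dotvC dotvZr dotvC. Qed.

Lemma dotvNr u v : dotv u (- v) = - dotv u v.
Proof. by rewrite -scaleN1r dotvZr mulN1r. Qed.

Lemma dotvBr u v x : dotv u (v - x) = dotv u v - dotv u x.
Proof. by rewrite dotvDr dotvNr. Qed.

Lemma dotvBl u v x : dotv (u - v) x = dotv u x - dotv v x.
Proof. by rewrite dotvC dotvBr !(dotvC x). Qed.

Lemma dot0v v : dotv 0 v = 0.
Proof. by rewrite -(scale0r 0) dotvZl mul0r. Qed.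

Lemma dotv_suml (I : finType) (A : {pred I}) (F : I -> 'rV[R]_d) v :
  dotv (\sum_(i in A) F i) v = \sum_(i in A) dotv (F i) v.
Proof.
apply: (big_ind2 (fun u a => dotv u v = a)) => //; first exact: dot0v.
by move=> u a w b <- <-; rewrite dotvDl.
Qed.

Lemma dotvE u v : (u *m v^T) 0 0 = dotv u v.
Proof. by rewrite mxE; apply: eq_bigr => i _; rewrite mxE. Qed.

Lemma dotvv_eq0 u : (dotv u u == 0) = (u == 0).
Proof.
apply/idP/eqP => [|->]; last by rewrite dot0v.
rewrite psumr_eq0 => [/allP u0|i _]; last by rewrite -expr2 sqr_ge0.
apply/rowP => i; rewrite mxE; apply/eqP.
by have := u0 i (mem_index_enum _); rewrite mulf_eq0 orbb.
Qed.

Lemma conv_hull_le (A : set 'rV[R]_d) u b :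
  (forall x, A x -> dotv u x <= b) ->
  forall x, conv_hull A x -> dotv u x <= b.
Proof.
move=> Ab x /(_ [set y | dotv u y <= b]%classic); apply; split => // y z l.
rewrite !inE /= => yb zb; rewrite /conv /= dotvDr !dotvZr.
have l0 : 0 <= l%:num by [].
have l1 : l%:num <= 1 by [].
rewrite /onem; nra.
Qed.

Lemma conv_hull_gen (A : set 'rV[R]_d) x : A x -> conv_hull A x.
Proof. by move=> Ax B [_]; apply. Qed.

End DotProduct.

Section FacesOfHull.
Variables (R : realType) (d : nat) (J : finType) (p : J -> 'rV[R]_d).

Definition exposed (T : {set J}) : Prop :=
  exists (u : 'rV[R]_d) (b : R), forall j, dotv u (p j) <= b ?= iff (j \in T).

Let P : set 'rV[R]_d := conv_hull (range p).

Definition face_index (F : set 'rV[R]_d) : {set J} :=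
  [set j | `[< F (p j) >]]%SET.

Lemma face_indexP F j : reflect (F (p j)) (j \in face_index F).
Proof. by rewrite finset.in_set; exact: asboolP. Qed.

Lemma hull_le u b : (forall j, dotv u (p j) <= b) ->
  forall x, P x -> dotv u x <= b.
Proof. by move=> pb; apply: conv_hull_le => _ [j _ <-]. Qed.

Lemma hull_gen j : P (p j).
Proof. by apply: conv_hull_gen; exists j. Qed.

Lemma face_index_exposed F : face P F -> exposed (face_index F).
Proof.
move=> [u [b [Pb ->]]]; exists u, b => j; split; first by apply: Pb; exact: hull_gen.
by apply/eqP/face_indexP => [<-|[]//]; split => //; exact: hull_gen.
Qed.

Lemma exposed_face T : exposed T -> exists2 F, face P F & face_index F = T.
Proof.
move=> [u [b Tb]]; exists (P `&` [set x | dotv u x = b])%classic.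
  by exists u, b; split => //; apply: hull_le => j; rewrite Tb.
apply/setP => j; rewrite -(eq_leif (Tb j)).
by apply/face_indexP/eqP => [[]//|pb]; split => //; exact: hull_gen.
Qed.

(* If [F'] is cut out by [u' x = b'] and [F] by [u x = b], then for [M] large
   [b' - u' x <= M (b - u x)] holds at the generators, hence on the hull. *)
Lemma face_subset F F' : face P F -> face P F' ->
  (F `<=` F')%classic <-> face_index F \subset face_index F'.
Proof.
move=> fF fF'; split => [FF'|].
  by apply/fintype.subsetP => j /face_indexP Fj; exact/face_indexP/FF'.
case: fF fF' => [u [b [Pb ->]]] [u' [b' [Pb' ->]]] /fintype.subsetP sub.
(* At a generator on [F] the denominator is 0 and so is the quotient, by convention; the sum
   dominates each of the other quotients. *)
set M := \sum_j `|(b' - dotv u' (p j)) / (b - dotv u (p j))|.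
have M0 : 0 <= M by apply: sumr_ge0.
have Mp j : dotv (M *: u - u') (p j) <= M * b - b'.
  rewrite dotvBl dotvZl.
  have [bj|nbj] := eqVneq (dotv u (p j)) b.
    suff -> : dotv u' (p j) = b' by rewrite bj.
    suff /sub/face_indexP[] : j \in face_index (P `&` [set x | dotv u x = b])%classic by [].
    by apply/face_indexP; split => //; exact: hull_gen.
  have bj : 0 < b - dotv u (p j).
    by rewrite subr_gt0 lt_neqAle nbj Pb//; exact: hull_gen.
  suff : b' - dotv u' (p j) <= M * (b - dotv u (p j)) by lra.
  rewrite -ler_pdivrMr// (le_trans (ler_norm _))//.
  by rewrite /M (bigD1 j)//= lerDl sumr_ge0.
move=> x [Px /= bx]; split => //=.
have := hull_le Mp Px; rewrite dotvBl dotvZl bx => xb.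
have := Pb' x Px; lra.
Qed.

Lemma face_eqP F F' : face P F -> face P F' ->
  face_index F = face_index F' -> F = F'.
Proof.
move=> fF fF' e; rewrite eqEsubset.
by split; [apply/(face_subset fF fF')|apply/(face_subset fF' fF)]; rewrite e.
Qed.

Lemma face_index0 F : face P F -> face_index F = finset.set0 -> F = classical_sets.set0.
Proof.
move=> fF F0; have f0 : face P classical_sets.set0.
  exists 0, 1; split => [x _|]; first by rewrite dot0v.
  apply/esym; rewrite -subset0 => x [_] /=; rewrite dot0v => /eqP.
  by rewrite eq_sym oner_eq0.
apply: face_eqP => //; rewrite F0; apply/setP => j; rewrite finset.in_set0.
by apply/esym/negP => /face_indexP.
Qed.

Lemma vertex_hull v : vertex P v -> exists j, v = p j.
Proof.
move=> fv; have [v0|[j]] := set_0Vmem (face_index [set v]%classic).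
  have : [set v]%classic v by [].
  by rewrite (face_index0 fv v0).
by move=> /face_indexP /= <-; exists j.
Qed.

End FacesOfHull.

(** * Polynomials and supporting hyperplanes of the cyclic polytope *)

Section NodePolynomials.
Variables (R : realType) (k : nat) (t : 'I_k -> R).
Hypothesis t_lt : {mono t : i j / (i < j)%N >-> i < j}.

Let t_inj : injective t.
Proof.
move=> i j tij; apply: val_inj => /=.
by case: (ltngtP i j) => // ij; have := t_lt i j; have := t_lt j i;
  rewrite ij tij ltxx.
Qed.

Definition node_poly (A : {set 'I_k}) : {poly R} :=
  \prod_(a in A) ('X - (t a)%:P).

Lemma size_node_poly A : size (node_poly A) = #|A|.+1.
Proof. by rewrite /node_poly -big_enum size_prod_XsubC cardE. Qed.

Lemma horner_node_poly A x : (node_poly A).[x] = \prod_(a in A) (x - t a).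
Proof. by rewrite horner_prod; apply: eq_bigr => a _; rewrite !hornerE. Qed.

Lemma node_poly_eq0 A j : ((node_poly A).[t j] == 0) = (j \in A).
Proof.
rewrite horner_node_poly prodf_seq_eq0; apply/hasP/idP => [[a _]|jA].
  by case/andP => aA; rewrite subr_eq0 => /eqP /t_inj ->.
by exists j; rewrite ?mem_index_enum// jA subrr eqxx.
Qed.

Lemma node_interpolation (A : {set 'I_k}) (c : 'I_k -> R) :
  exists2 h : {poly R}, (size h <= #|A|)%N & forall a, a \in A -> h.[t a] = c a.
Proof.
exists (\sum_(a in A) (c a / (node_poly (A :\ a)).[t a]) *: node_poly (A :\ a)).
  apply: (leq_trans (size_sum _ _ _)); apply/bigmax_leqP => a aA.
  by rewrite (leq_trans (size_scale_leq _ _))// size_node_poly (cardsD1 a A) aA.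
move=> a aA; rewrite horner_sum (bigD1 a)//= hornerZ divfK ?node_poly_eq0 ?inE ?eqxx//.
rewrite big1 ?addr0// => b /andP[bA ba]; rewrite hornerZ.
have /eqP -> : (node_poly (A :\ b)).[t a] == 0.
  by rewrite node_poly_eq0 in_setD1 aA eq_sym ba.
by rewrite mulr0.
Qed.

(** A node of [A] between [t i] and [t j] contributes a negative factor to the product, any other
    node a positive one. *)
Lemma sgr_node_poly (A : {set 'I_k}) (i j : 'I_k) : i \notin A -> j \notin A -> (i < j)%N ->
  Num.sg ((node_poly A).[t i] * (node_poly A).[t j]) =
  (-1) ^+ #|[set s in A | (i < s < j)%N]%SET|.
Proof.
move=> iA jA ij; rewrite !horner_node_poly -big_split /=.
rewrite (bigID (fun s : 'I_k => (i < s < j)%N)) /= sgrM.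
rewrite !(big_morph _ (@sgrM R) (@sgr1 R)).
rewrite [X in _ * X]big1 ?mulr1; last first.
  move=> s /andP[sA]; rewrite negb_and -!leqNgt => sij.
  apply: gtr0_sg; have i_s : s != i :> nat.
    by apply: contraNneq iA => /val_inj <-.
  have j_s : j != s :> nat by apply: contraNneq jA => /val_inj ->.
  case/orP: sij => [si|js].
    have {}si : (s < i)%N by rewrite ltn_neqAle i_s.
    by rewrite mulr_gt0// subr_gt0 t_lt// (ltn_trans si).
  have {}js : (j < s)%N by rewrite ltn_neqAle j_s.
  by rewrite nmulr_rgt0 subr_lt0 t_lt// (ltn_trans ij).
rewrite (eq_bigr (fun=> -1)) => [|s /andP[_ /andP[is_ sj]]].
  by rewrite prodr_const; congr (_ ^+ _); apply: eq_card => s; rewrite !inE.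
by rewrite ltr0_sg// nmulr_rlt0 ?subr_lt0 ?subr_gt0 ?t_lt.
Qed.

Lemma roots_card (g : {poly R}) n (A : {set 'I_k}) : (size g <= n.+1)%N ->
  (forall a, a \in A -> g.[t a] = 0) -> (n < #|A|)%N -> g = 0.
Proof.
move=> gn gA nA; apply: contraTeq nA => g0; rewrite -leqNgt -ltnS.
apply: leq_trans gn; rewrite cardE -(size_map t); apply: max_poly_roots => //.
  apply/allP => x /mapP[a]; rewrite mem_enum => aA ->.
  by rewrite rootE gA.
by rewrite map_inj_uniq ?enum_uniq.
Qed.

(* Adding the right multiple of [g] to [h] tilts the supporting hyperplane [g]
   about the face [T] until it meets another node [j1]. *)
Lemma tilt (g h : {poly R}) (T : {set 'I_k}) :
  (forall j, 0 <= g.[t j] ?= iff (j \in T)) -> T != finset.setT ->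
  (forall j, j \in T -> 0 <= h.[t j]) ->
  exists mu, exists2 j1, j1 \notin T &
    (forall j, 0 <= (h + mu *: g).[t j]) /\ (h + mu *: g).[t j1] = 0.
Proof.
move=> gT; rewrite -finset.subTset => /subsetPn[j0 _ j0T] hT.
have g_gt0 j : j \notin T -> 0 < g.[t j].
  by move=> jT; rewrite lt_neqAle !gT andbT.
have [j1 j1T max_j1] := @arg_maxP _ _ _ j0 [pred j | j \notin T]
  (fun j => - h.[t j] / g.[t j]) j0T.
exists (- h.[t j1] / g.[t j1]); exists j1 => //; split => [j|].
  rewrite hornerD hornerZ; have [jT|jT] := boolP (j \in T).
    by have /eqP <- : 0 == g.[t j] by [rewrite gT]; rewrite mulr0 addr0 hT.
  have := max_j1 j jT; rewrite /= ler_pdivrMr ?g_gt0//; lra.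
by rewrite hornerD hornerZ divfK ?subrr// gt_eqF// g_gt0.
Qed.

End NodePolynomials.

(** Gale's evenness condition, which characterizes the facets when the nodes are listed in
    increasing order. *)
Definition gale (d k : nat) (S : {set 'I_k}) : bool :=
  (#|S| == d) && [forall i, forall j, [&& i \notin S, j \notin S & (i < j)%N] ==>
    ~~ odd #|[set s in S | (i < s < j)%N]%SET|].

Section MomentCurve.
Variables (R : realType) (d k : nat) (t : 'I_k -> R).
Hypothesis t_lt : {mono t : i j / (i < j)%N >-> i < j}.
Hypothesis d_lt_k : (d < k)%N.

Let p j := moment_curve d (t j).
Implicit Types (S T : {set 'I_k}) (g h : {poly R}).

(** Along the moment curve an affine functional is a polynomial of degree at most [d], so [g] is a
    supporting half-space read at the nodes. *)
Definition supports g T : Prop :=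
  (size g <= d.+1)%N /\ forall j, 0 <= g.[t j] ?= iff (j \in T).

Lemma supports_exposed g T : supports g T -> exposed p T.
Proof.
move=> [gd gT]; exists (\row_i - g`_i.+1), g`_0 => j.
suff e : dotv (\row_i - g`_i.+1) (p j) = g`_0 - g.[t j].
  rewrite e; split; first by rewrite gerBl gT.
  by rewrite -subr_eq0 addrAC subrr sub0r oppr_eq0 eq_sym gT.
rewrite (horner_coef_wide _ gd) big_ord_recl expr0 mulr1 opprD addrA subrr add0r.
by rewrite -sumrN; apply: eq_bigr => i _; rewrite !mxE mulNr.
Qed.

Lemma exposed_supports T : exposed p T -> exists g, supports g T.
Proof.
move=> [u [b ubT]]; exists (b%:P - \sum_(i < d) u 0 i *: 'X^(i.+1)); split.
  rewrite (leq_trans (size_polyD _ _))// geq_max size_polyN; apply/andP; split.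
    by rewrite (leq_trans (size_polyC_leq1 _)).
  apply: leq_trans (size_sum _ _ _) _; apply/bigmax_leqP => i _.
  by rewrite (leq_trans (size_scale_leq _ _))// size_polyXn ltnS.
move=> j; have -> : (b%:P - \sum_(i < d) u 0 i *: 'X^(i.+1)).[t j] = b - dotv u (p j).
  rewrite hornerD hornerN hornerC horner_sum; congr (_ - _).
  by apply: eq_bigr => i _; rewrite hornerZ hornerXn mxE.
split; first by rewrite subr_ge0 ubT.
by rewrite eq_sym subr_eq0 eq_sym ubT.
Qed.

Lemma supports_card g T : supports g T -> T != finset.setT -> (#|T| <= d)%N.
Proof.
move=> [gd gT] TT; rewrite leqNgt; apply: contra TT => dT.
have g0 : g = 0.
  by apply: (roots_card t_lt gd _ dT) => a aT; apply/esym/eqP; rewrite gT.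
by apply/eqP/setP => j; rewrite -gT g0 horner0 eqxx finset.in_setT.
Qed.

(** Both [g] and [node_poly t S] have degree at most [d] and vanish at the [d] nodes of [S], so they
    are proportional; as [g] is positive off [S], the node polynomial has constant sign there. *)
Lemma supports_gale g S : supports g S -> #|S| = d -> gale d S.
Proof.
move=> [gd gS] Sd; rewrite /gale Sd eqxx /=.
have g_gt0 l : l \notin S -> 0 < g.[t l].
  by move=> lS; rewrite lt_neqAle !gS andbT.
apply/forallP => i; apply/forallP => j; apply/implyP => /and3P[iS jS ij].
set f := node_poly t S; have fi0 : f.[t i] != 0 by rewrite node_poly_eq0.
have fj0 : f.[t j] != 0 by rewrite node_poly_eq0.
have /eqP : g - (g.[t i] / f.[t i]) *: f = 0.
  apply: (@roots_card R k t t_lt _ d (i |: S)).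
  - rewrite (leq_trans (size_polyD _ _))// size_polyN geq_max gd.
    by rewrite (leq_trans (size_scale_leq _ _))// size_node_poly Sd.
  - move=> a; rewrite hornerD hornerN hornerZ => /setU1P[->|aS].
      by rewrite divfK// subrr.
    have /eqP -> : f.[t a] == 0 by rewrite node_poly_eq0.
    by have /eqP <- : 0 == g.[t a] by [rewrite gS]; rewrite mulr0 subrr.
  - by rewrite cardsU1 iS Sd.
rewrite subr_eq0 => /eqP gE; have := g_gt0 j jS; rewrite gE hornerZ.
rewrite mulrAC -mulrA pmulr_rgt0 ?g_gt0// => fji.
have : 0 < f.[t i] * f.[t j].
  have f2 : 0 < f.[t i] ^+ 2 by rewrite exprn_even_gt0.
  by have := mulr_gt0 f2 fji; congr (_ < _); field.
rewrite -sgr_gt0 sgr_node_poly// -signr_odd.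
by case: (odd _) => //; rewrite expr1 oppr_gt0 ltr10.
Qed.

Lemma gale_neqT S : gale d S -> S != finset.setT.
Proof.
case/andP => /eqP Sd _; apply: contraTneq d_lt_k => ST.
by rewrite -Sd ST cardsT card_ord ltnn.
Qed.

Lemma gale_supports S : gale d S -> exists g, supports g S.
Proof.
move=> gS; have /andP[/eqP Sd /forallP galeS] := gS.
have [j0 _ j0S] : exists2 j, j \in [set: 'I_k]%SET & j \notin S.
  by apply/subsetPn; rewrite finset.subTset gale_neqT.
set f := node_poly t S; exists (Num.sg f.[t j0] *: f); split.
  by rewrite (leq_trans (size_scale_leq _ _))// size_node_poly Sd.
have f0 j : j \notin S -> f.[t j] != 0 by move=> jS; rewrite node_poly_eq0.
have sg1 i j : i \notin S -> j \notin S -> (i < j)%N -> Num.sg (f.[t i] * f.[t j]) = 1.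
  move=> iS jS ij; rewrite sgr_node_poly// -signr_odd.
  by have /forallP/(_ j) := galeS i; rewrite iS jS ij /= => /negPf ->.
move=> j; rewrite hornerZ; have [jS|jS] := boolP (j \in S).
  have /eqP -> : f.[t j] == 0 by rewrite node_poly_eq0.
  by rewrite mulr0; split; rewrite ?lexx ?eqxx.
suff : 0 < Num.sg f.[t j0] * f.[t j] by move=> fj; split; rewrite ?ltW// lt_eqF.
rewrite -sgr_gt0 sgrM sgr_id -sgrM.
have [jj0|j0j|/val_inj <-] := ltngtP j j0; last first.
- by rewrite -expr2 sgr_gt0 exprn_even_gt0 ?f0.
- by rewrite sg1.
- by rewrite mulrC sg1.
Qed.

(** The polytope is simplicial: a polynomial that is 0 on [T] and 1 on the rest of [S] is corrected
    off [S] by a large multiple of the polynomial supporting [S]. *)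
Lemma gale_sub_supports S T : gale d S -> T \subset S -> exists g, supports g T.
Proof.
move=> gS TS; have [g [gd gSP]] := gale_supports gS.
have /andP[/eqP Sd _] := gS.
have [h hS hT] := node_interpolation t_lt S (fun j => (j \notin T)%:R).
set M := 1 + \sum_j `|h.[t j] / g.[t j]|.
have M0 : 0 < M by rewrite ltr_pwDl// sumr_ge0.
exists (h + M *: g); split.
  rewrite (leq_trans (size_polyD _ _))// geq_max.
  rewrite (leq_trans hS) ?Sd//= (leq_trans (size_scale_leq _ _))//.
move=> j; rewrite hornerD hornerZ; have [jS|jS] := boolP (j \in S).
  have /eqP <- : 0 == g.[t j] by rewrite gSP.
  rewrite mulr0 addr0 hT//; case: (j \in T) => /=; split; rewrite ?lexx ?eqxx ?ler01//.
  by rewrite eq_sym oner_eq0.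
have g0 : 0 < g.[t j] by rewrite lt_neqAle !gSP andbT.
have -> : j \in T = false by apply: contraNF jS; apply: fintype.subsetP TS j.
suff : 0 < h.[t j] + M * g.[t j] by move=> fj; split; rewrite ?ltW// lt_eqF.
rewrite -(divfK (lt0r_neq0 g0) h.[t j]) -mulrDl mulr_gt0//.
rewrite /M (bigD1 j)//=; set a := _ / _.
have : 0 <= \sum_(i < k | i != j) `|h.[t i] / g.[t i]| by apply: sumr_ge0.
have := ler_norm (- a); rewrite normrN; lra.
Qed.

(** By induction on [d - #|T|]: while [T] has fewer than [d] labels, tilting about it gives a
    supporting polynomial with a larger zero set. *)
Lemma supports_sub_gale g T : supports g T -> T != finset.setT ->
  exists2 S, gale d S & T \subset S.
Proof.
have [n] := ubnP (d - #|T|)%N; elim: n g T => // n IHn g T; rewrite ltnS => dTn gT TT.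
have [gd gTP] := gT; have := supports_card gT TT; rewrite leq_eqVlt.
case/predU1P => [Td|Td]; first by exists T => //; exact: supports_gale gT Td.
have /card_gt1P[i [j [iT jT ij]]] : (1 < #|~: T|)%N.
  by rewrite cardsCs finset.setCK card_ord ltn_subRL (leq_ltn_trans _ d_lt_k)// addn1.
rewrite !finset.in_setC in iT jT.
(* If [h + mu *: g] vanishes at [i], where [h] does, then [mu = 0] and its value at [j] is 1. This
   keeps the new zero set proper. *)
have [h hT hij] := node_interpolation t_lt (i |: (j |: T)) (fun l => (l == j)%:R).
have g_gt0 l : l \notin T -> 0 < g.[t l].
  by move=> lT; rewrite lt_neqAle !gTP andbT.
have iU : i \notin j |: T by rewrite !inE negb_or ij.
have hd : (size h <= d.+1)%N.
  by rewrite (leq_trans hT)// cardsU1 iU cardsU1 jT.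
have [|mu [j1 j1T [f_ge0 f_j1]]] := @tilt R k t g h T gTP TT.
  by move=> l lT; rewrite hij ?inE ?lT ?orbT// ler0n.
set f := h + mu *: g in f_ge0 f_j1.
set T' := [set l | 0 == f.[t l]]%SET.
have fT' : supports f T'.
  split; last by move=> l; split => //; rewrite finset.in_set.
  rewrite (leq_trans (size_polyD _ _))// geq_max hd.
  by rewrite (leq_trans (size_scale_leq _ _)).
have TT' : T \proper T'.
  apply/fintype.properP; split; last first.
    by exists j1 => //; rewrite finset.in_set f_j1.
  apply/fintype.subsetP => l lT; rewrite finset.in_set hornerD hornerZ.
  have /eqP <- : 0 == g.[t l] by rewrite gTP.
  have lj : l != j by apply: contraNneq jT => <-.
  by rewrite mulr0 addr0 hij ?inE ?lT ?orbT// (negPf lj).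
have [||S gS T'S] := IHn f T' _ fT'.
- apply: leq_trans dTn; rewrite ltn_sub2l// proper_card//.
- apply/eqP => T'T.
  have fE l : f.[t l] = 0.
    by have := finset.in_setT l; rewrite -T'T finset.in_set => /eqP <-.
  have := fE i; have := fE j; rewrite !hornerD !hornerZ !hij ?inE ?eqxx ?orbT//=.
  rewrite (negPf ij) add0r => fj /eqP; rewrite mulf_eq0 (gt_eqF (g_gt0 i iT)) orbF => /eqP mu0.
  by move: fj; rewrite mu0 mul0r addr0 => /eqP; rewrite oner_eq0.
- by exists S => //; exact: fintype.subset_trans (proper_sub TT') T'S.
Qed.

(** The facet across the ridge [S :\ i]: tilting a polynomial that is 1 at [i] and 0 on the rest of
    [S] keeps the ridge and gains a label [j1]. *)
Lemma gale_neighbor S i : gale d S -> i \in S ->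
  exists2 S', gale d S' & i \notin S' /\ S :\ i \subset S'.
Proof.
move=> gS iS; have [g [gd gSP]] := gale_supports gS.
have /andP[/eqP Sd _] := gS.
have [h hS hE] := node_interpolation t_lt S (fun j => (j == i)%:R).
have [|mu [j1 j1S [f_ge0 f_j1]]] := @tilt R k t g h S gSP (gale_neqT gS).
  by move=> l lT; rewrite hE// ler0n.
set f := h + mu *: g in f_ge0 f_j1.
have fE l : l \in S -> f.[t l] = (l == i)%:R.
  move=> lS; have /eqP g0 : 0 == g.[t l] by rewrite gSP.
  by rewrite hornerD hornerZ -g0 mulr0 addr0 hE.
set T := [set l | 0 == f.[t l]]%SET.
have fT : supports f T.
  split; last by move=> l; split => //; rewrite finset.in_set.
  rewrite (leq_trans (size_polyD _ _))// geq_max (leq_trans hS) ?Sd ?leqnSn//=.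
  by rewrite (leq_trans (size_scale_leq _ _)).
have iT : i \notin T by rewrite finset.in_set fE// eqxx eq_sym oner_eq0.
have ST : S :\ i \subset T.
  apply/fintype.subsetP => l /setD1P[li lS].
  by rewrite finset.in_set fE// (negPf li).
exists T; last by [].
apply: (supports_gale fT); apply/anti_leq/andP; split.
  by apply: (supports_card fT); apply: contraNneq iT => ->; rewrite finset.in_setT.
have <- : #|j1 |: S :\ i| = d.
  by rewrite cardsU1 finset.in_setD1 (negPf j1S) andbF -Sd [in RHS](cardsD1 i) iS.
apply: subset_leq_card; rewrite finset.subUset ST andbT finset.sub1set finset.in_set.
by rewrite f_j1.
Qed.

End MomentCurve.

(** * Realizing the dual type *)

Section FaceLattice.
Variables (R : realType) (d : nat).
Implicit Types P Q : set 'rV[R]_d.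

Lemma le_faceE P (F G : face_lattice P) :
  (F <= G)%O = `[< (face_set F `<=` face_set G)%classic >].
Proof. by []. Qed.

(** By antisymmetry, a relation that is total on both sides and reverses the order is the graph of a
    bijection. *)
Lemma dual_poset_isomorphic Q P (rel : face_lattice Q -> face_lattice P -> Prop) :
  (forall F, exists G, rel F G) -> (forall G, exists F, rel F G) ->
  (forall F G F' G', rel F G -> rel F' G' -> (F <= F')%O = (G' <= G)%O) ->
  poset_isomorphic (face_lattice Q) (dual_type P).
Proof.
move=> /choice[f fP] /choice[g gP] relP.
exists (f : face_lattice Q -> dual_type P); last first.
  by move=> F F'; rewrite leEdual; exact/esym/relP.
exists g => [F|G].
  have e := relP _ _ _ _ (fP F) (gP (f F)); have e' := relP _ _ _ _ (gP (f F)) (fP F).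
  by apply/le_anti; rewrite e e' !lexx.
have e := relP _ _ _ _ (gP G) (fP (g G)); have e' := relP _ _ _ _ (fP (g G)) (gP G).
by apply/(@le_anti _ (face_lattice P)); rewrite -e -e' !lexx.
Qed.

End FaceLattice.

Section Realization.
Variables (R : realType) (d k : nat) (t : 'I_k -> R).
Hypothesis t_lt : {mono t : i j / (i < j)%N >-> i < j}.
Hypothesis d_lt_k : (d < k)%N.
Variables (n : 'I_k -> 'rV[R]_d) (b : 'I_k -> R).

Let p j := moment_curve d (t j).
Local Notation J := {S : {set 'I_k} | gale d S}.
Variable q : J -> 'rV[R]_d.
Hypothesis qP : forall (S : J) i, dotv (n i) (q S) <= b i ?= iff (i \in val S).

(* At the vertex [q S] the normals [n i], [i \in S], are dual to the edge
   directions towards the vertices adjacent to [q S]. *)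
Lemma vertex_frame (S : J) :
  exists (m : 'I_d -> 'I_k) (N : 'I_d -> J),
    [/\ forall l, m l \in val S,
        forall i l, dotv (n (m i)) (q (N l) - q S) <= 0 ?= iff (i != l) &
        forall v, (forall l, dotv v (q (N l) - q S) = 0) -> v = 0].
Proof.
have [/andP[/eqP Sd _] gS] := (valP S, valP S).
pose m (l : 'I_d) : 'I_k := enum_val (cast_ord (esym Sd) l).
have mS l : m l \in val S by exact: enum_valP.
have m_inj : injective m by move=> i l /enum_val_inj /cast_ord_inj.
have /choice[N NP] (l : 'I_d) : exists S' : J, m l \notin val S' /\ val S :\ m l \subset val S'.
  have [S' gS' S'P] := gale_neighbor t_lt d_lt_k gS (mS l).
  by exists (exist _ S' gS').
have mN i l : dotv (n (m i)) (q (N l) - q S) <= 0 ?= iff (i != l).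
  have [mlN subN] := NP l.
  have -> : (i != l) = (m i \in val (N l)).
    apply/idP/idP => [il|]; last by apply: contraTneq => ->.
    by apply: (fintype.subsetP subN); rewrite in_setD1 mS (inj_eq m_inj) il.
  have /eqP -> : 0 == dotv (n (m i)) (q S) - dotv (n (m i)) (q S) by rewrite subrr.
  have /eqP e : dotv (n (m i)) (q S) == b (m i) by rewrite qP.
  rewrite dotvBr e; split; first by rewrite lerB// qP.
  by rewrite (inj_eq (addIr _)) qP.
exists m, N; split=> // v vN.
pose M := \matrix_(i, j) n (m i) 0 j; pose E := \matrix_(l, j) (q (N l) - q S) 0 j.
have ME i l : (M *m E^T) i l = dotv (n (m i)) (q (N l) - q S).
  by rewrite mxE; apply: eq_bigr => j _; rewrite !mxE.
(* [M *m E^T] is diagonal with nonzero diagonal. Hence the normals form a basis, and pairing a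
   combination of them with the edge vectors reads off its coefficients. *)
have aME (a : 'rV_d) l : (a *m M *m E^T) 0 l = a 0 l * dotv (n (m l)) (q (N l) - q S).
  rewrite -mulmxA mxE (bigD1 l)//= big1 ?addr0 ?ME// => i il.
  by rewrite ME; have /eqP -> : dotv (n (m i)) (q (N l) - q S) == 0; rewrite ?mulr0 ?mN.
have ME0 l : dotv (n (m l)) (q (N l) - q S) != 0 by rewrite mN eqxx.
have M_unit : M \in unitmx.
  rewrite -row_free_unit; apply: inj_row_free => a aM; apply/rowP => l.
  have := aME a l; rewrite aM mul0mx !mxE => /esym/eqP.
  by rewrite mulf_eq0 (negPf (ME0 l)) orbF => /eqP.
have vE : v *m E^T = 0.
  apply/rowP => l; rewrite !mxE -[RHS](vN l); apply: eq_bigr => j _.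
  by rewrite !mxE.
rewrite -(mulmxKV M_unit v); set a := v *m _.
have -> : a = 0; last by rewrite mul0mx.
apply/rowP => l; have := aME a l.
rewrite mulmxKV// vE !mxE => /esym/eqP.
by rewrite mulf_eq0 (negPf (ME0 l)) orbF => /eqP.
Qed.

(** In the basis of the normals at [q S], each coefficient of [u] is the quotient of a nonpositive
    by a negative pairing with an edge vector. [T] collects the normals with nonzero coefficient,
    and [u] is maximal exactly at the vertices on all these facets. *)
Lemma normal_cone (S : J) u :
  (forall S', dotv u (q S') <= dotv u (q S)) ->
  exists2 T : {set 'I_k}, T \subset val S &
    forall S', (dotv u (q S') == dotv u (q S)) = (T \subset val S').
Proof.
move=> uS; have [m [N [mS mN N_span]]] := vertex_frame S.
have ME0 l : dotv (n (m l)) (q (N l) - q S) < 0.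
  by rewrite lt_neqAle !mN eqxx.
pose a l := dotv u (q (N l) - q S) / dotv (n (m l)) (q (N l) - q S).
have a_ge0 l : 0 <= a l.
  by rewrite mulr_le0// ?dotvBr ?subr_le0// invr_le0 -dotvBr ltW.
have uE : u = \sum_l a l *: n (m l).
  apply/eqP; rewrite -subr_eq0; apply/eqP/N_span => l.
  rewrite dotvBl dotv_suml (bigD1 l)//= big1 ?addr0 => [|i il].
    by rewrite dotvZl divfK ?subrr// lt_eqF.
  rewrite dotvZl; have /eqP -> : dotv (n (m i)) (q (N l) - q S) == 0 by rewrite mN.
  by rewrite mulr0.
exists [set m l | l in [pred l | a l != 0]]%SET.
  by apply/fintype.subsetP => _ /imsetP[l _ ->].
move=> S'; have : \sum_(l < d) 0 <= \sum_l a l * (b (m l) - dotv (n (m l)) (q S')) ?=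
    iff [forall (l | true), (a l == 0) || (m l \in val S')].
  apply: leif_sum => l _; split.
    by rewrite mulr_ge0// subr_ge0 qP.
  by rewrite eq_sym mulf_eq0 subr_eq0 [b _ == _]eq_sym qP.
have -> : \sum_l a l * (b (m l) - dotv (n (m l)) (q S')) = dotv u (q S - q S').
  rewrite uE dotv_suml; apply: eq_bigr => l _; rewrite dotvZl dotvBr.
  by have /eqP <- : dotv (n (m l)) (q S) == b (m l) by rewrite qP.
move=> [_]; rewrite big1_eq dotvBr eq_sym subr_eq0 eq_sym => ->.
apply/forallP/fintype.subsetP => [aT _ /imsetP[l al ->]|TS l /=].
  by have /= := aT l; rewrite inE in al; rewrite (negPf al).
have [//|al /=] := eqVneq (a l) 0; apply: TS; apply/imsetP; exists l => //.
Qed.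

Let P : set 'rV[R]_d := conv_hull (range p).
Let Q : set 'rV[R]_d := conv_hull (range q).

Lemma facets_exposed (T : {set 'I_k}) : exposed q [set S : J | T \subset val S]%SET.
Proof.
exists (\sum_(i in T) n i), (\sum_(i in T) b i) => S.
rewrite dotv_suml finset.in_set.
have -> : (T \subset val S) = [forall (i | i \in T), i \in val S].
  by apply/fintype.subsetP/forall_inP.
by apply: leif_sum.
Qed.

(** The first clause turns inclusions of label sets into reverse inclusions of vertex sets, the
    second turns them back. The empty face of [Q] is matched with [P] itself. *)
Let Rel (F : face_lattice Q) (G : face_lattice P) : Prop :=
  face_index q F = [set S : J | face_index p G \subset val S]%SET /\
  face_index p G = [set i | [forall S : J, (S \in face_index q F) ==> (i \in val S)]]%SET.

Let Rel_total_l F : exists G, Rel F G.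
Proof.
have fF : face Q F by apply/asboolP/faceP.
have exG T : exposed p T -> exists G : face_lattice P, face_index p G = T.
  by move=> /exposed_face[G fG GT]; exists (Face (asboolT fG)).
have [F0|[S SF]] := set_0Vmem (face_index q F).
  have [|G GT] := exG finset.setT.
    by exists 0, 0 => j; rewrite dot0v finset.in_setT; split; rewrite ?lexx ?eqxx.
  exists G; split; rewrite GT F0; apply/setP => i.
    rewrite finset.in_set0 finset.in_set finset.subTset; apply/esym/negbTE.
  exact: (gale_neqT d_lt_k (valP i)).
  rewrite finset.in_setT finset.in_set; apply/esym/forallP => S.
  by rewrite finset.in_set0.
have [u [b' ub]] := face_index_exposed fF.
have uS : dotv u (q S) = b' by apply/eqP; rewrite ub.
have [|T TS uT] := @normal_cone S u.
  by move=> S'; rewrite uS ub.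
have FT : face_index q F = [set S : J | T \subset val S]%SET.
  by apply/setP => S'; rewrite finset.in_set -uT uS ub.
have [|G GT] := exG T.
  have [g gT] := gale_sub_supports t_lt d_lt_k (valP S) TS.
  exact: supports_exposed gT.
exists G; split; rewrite GT//; apply/setP => i; rewrite finset.in_set.
apply/idP/forallP => [iT S'|Ti].
  by apply/implyP; rewrite FT finset.in_set => /fintype.subsetP; apply.
(* If [i] were common to all vertices of [F] without being in [T], the neighbour of [S] across
   [S :\ i] would still contain [T], hence lie in [F], and yet miss [i]. *)
apply: contraT => iT.
have iS : i \in val S by have := Ti S; rewrite SF.
have [S' gS' [iS' SS']] := gale_neighbor t_lt d_lt_k (valP S) iS.
have := Ti (exist _ S' gS'); rewrite FT finset.in_set /= (negPf iS') implybF.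
case/negP; apply: fintype.subset_trans SS'; apply/fintype.subsetP => j jT.
rewrite in_setD1 (fintype.subsetP TS)// andbT.
by apply: contraNneq iT => <-.
Qed.

Let Rel_total_r G : exists F, Rel F G.
Proof.
have fG : face P G by apply/asboolP/faceP.
have [F fF FT] := exposed_face (facets_exposed (face_index p G)).
exists (Face (asboolT fF)); split => //=; rewrite {}FT.
apply/setP => i; rewrite [RHS]finset.in_set.
apply/idP/forallP => [iG S|Gi].
  by apply/implyP; rewrite finset.in_set => /fintype.subsetP; apply.
have [GT|GT] := eqVneq (face_index p G) finset.setT; first by rewrite GT finset.in_setT.
have [g gG] := exposed_supports (face_index_exposed fG).
have [S gS GS] := supports_sub_gale t_lt d_lt_k gG GT.
have := Gi (exist _ S gS); rewrite finset.in_set GS /= => iS.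
apply: contraT => iG; have [S' gS' [iS' SS']] := gale_neighbor t_lt d_lt_k gS iS.
have := Gi (exist _ S' gS'); rewrite finset.in_set /= (negPf iS') implybF.
case/negP; apply: fintype.subset_trans SS'; apply/fintype.subsetP => j jG.
rewrite in_setD1 (fintype.subsetP GS)// andbT.
by apply: contraNneq iG => <-.
Qed.

Lemma realization_dual : poset_isomorphic (face_lattice Q) (dual_type P).
Proof.
apply: dual_poset_isomorphic Rel_total_l Rel_total_r _.
move=> F G F' G' [FG GF] [FG' GF']; rewrite !le_faceE.
have [fF fF'] : face Q F /\ face Q F' by split; apply/asboolP/faceP.
have [fG fG'] : face P G /\ face P G' by split; apply/asboolP/faceP.
apply/asboolP/asboolP => [/(face_subset fF fF')|/(face_subset fG' fG)] /fintype.subsetP sub.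
  apply/(face_subset fG' fG)/fintype.subsetP => i.
  rewrite GF GF' !finset.in_set => /forallP iF'; apply/forallP => S.
  by apply/implyP => /sub SF'; have := iF' S; rewrite SF'.
apply/(face_subset fF fF')/fintype.subsetP => S.
rewrite FG FG' !finset.in_set => /fintype.subsetP GS; apply/fintype.subsetP => i /sub.
exact: GS.
Qed.

Lemma gale_inhabited : inhabited J.
Proof.
have s1 : supports d t 1 finset.set0.
  split=> [|j]; first by rewrite size_poly1.
  by rewrite hornerC finset.in_set0; split; rewrite ?ler01// eq_sym oner_eq0.
have [|S gS _] := supports_sub_gale t_lt d_lt_k s1.
  by apply: contraTneq d_lt_k => e; rewrite -(card_ord k) -cardsT -e cards0.
by constructor; exists S.
Qed.

(** The edge vectors at one vertex form a basis, so every point is an affine combination of that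
    vertex and its neighbours. *)
Lemma realization_full : full_polytope Q.
Proof.
split; first by exists (range q) => //; exact/finite_image/finite_finset.
have [S] := gale_inhabited; have [m [N [_ _ N_span]]] := vertex_frame S.
apply/seteqP; split => // x _.
pose E := \matrix_(l, j) (q (N l) - q S) 0 j.
have vE v l : (v *m E^T) 0 l = dotv v (q (N l) - q S).
  by rewrite mxE; apply: eq_bigr => j _; rewrite !mxE.
have E_unit : E \in unitmx.
  rewrite -unitmx_tr -row_free_unit; apply: inj_row_free => v v0.
  by apply: N_span => l; rewrite -vE v0 mxE.
pose a := (x - q S) *m invmx E.
have xE : x = q S + \sum_l a 0 l *: (q (N l) - q S).
  rewrite -[x in LHS](subrKC (q S)); congr (_ + _).
  rewrite -[LHS](mulmxKV E_unit) -/a mulmx_sum_row; apply: eq_bigr => l _.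
  by congr (_ *: _); apply/rowP => j; rewrite !mxE.
exists d.+1, (fun i => if unlift ord0 i is Some l then q (N l) else q S),
  (fun i => if unlift ord0 i is Some l then a 0 l else 1 - \sum_l a 0 l).
split.
- by move=> i; case: unliftP => *; exact: hull_gen.
- rewrite big_ord_recl unlift_none; under [X in _ + X]eq_bigr do rewrite liftK.
  by rewrite subrK.
- rewrite big_ord_recl unlift_none; under [X in _ + X]eq_bigr do rewrite liftK.
  rewrite xE scalerBl scale1r scaler_suml -addrA -sumrN -big_split /=.
  by congr (_ + _); apply: eq_bigr => l _; rewrite scalerBr addrC.
Qed.

End Realization.

Theorem inscribable_dual_cyclic (R : realType) (d k : nat) (t : 'I_k -> R)
    (n : 'I_k -> 'rV[R]_d) (b : 'I_k -> R) (c : 'rV[R]_d) (r : R) :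
  {mono t : i j / (i < j)%N >-> i < j} -> (d < k)%N -> 0 < r ->
  (forall S : {set 'I_k}, gale d S -> exists2 x, sphere c r x &
     forall i, dotv (n i) x <= b i ?= iff (i \in S)) ->
  inscribable R d (dual_type (conv_hull (range (fun j => moment_curve d (t j))))).
Proof.
move=> t_lt d_lt_k r0 nbP.
have /choice[q qP] (S : {S : {set 'I_k} | gale d S}) : exists x, sphere c r x /\
    forall i, dotv (n i) x <= b i ?= iff (i \in val S).
  by have [x] := nbP _ (valP S); exists x.
have qS S i : dotv (n i) (q S) <= b i ?= iff (i \in val S) by apply: (qP S).2.
exists (conv_hull (range q)); last exact: (realization_dual t_lt d_lt_k qS).
split; first exact: (realization_full t_lt d_lt_k qS).
by exists c, r; split => // v /vertex_hull[S ->]; apply: (qP S).1.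
Qed.

(** * Explicit inscribed realizations *)

(** Gale's condition refers to the order of the labels, so the parameters are sorted first. *)
Lemma sorted_cyclic_polytope (R : realType) (d k : nat) (P : set 'rV[R]_d) :
  cyclic_polytope k P -> exists2 t : 'I_k -> R, {mono t : i j / (i < j)%N >-> i < j} &
    P = conv_hull (range (fun j => moment_curve d (t j))).
Proof.
move=> [t t_inj ->]; set s := sort <=%O (codom t).
have s_size : size s = k by rewrite size_sort size_codom card_ord.
have s_uniq : uniq s by rewrite sort_uniq; apply/injectiveP.
exists (fun j => nth 0 s j).
  move=> i j; rewrite (@lt_sorted_ltn_nth _ _ 0 s) ?inE ?s_size//.
  by rewrite sort_lt_sorted -/s -(sort_uniq <=%O).
congr conv_hull; apply/seteqP; split => [_ [j _ <-]|_ [j _ <-]] /=.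
  have : t j \in s by rewrite mem_sort codom_f.
  by case/(nthP 0) => i; rewrite s_size => ik <-; exists (Ordinal ik).
have : nth 0 s j \in s by rewrite mem_nth ?s_size.
by rewrite mem_sort => /codomP[i ->]; exists i.
Qed.

Lemma cardsE_sum (I : finType) (S : {set I}) (Q : pred I) :
  #|[set s in S | Q s]%SET| = (\sum_(s in S) Q s)%N.
Proof.
by rewrite -sum1_card [RHS]big_mkcond [LHS]big_mkcond; apply: eq_bigr => i _;
  rewrite finset.in_set; case: (i \in S); case: (Q i).
Qed.

(** The facets are the pairs of cyclically adjacent labels; [s = k.-1] encodes the pair of [k.-1]
    and 0, since [s.+1] is then no label. *)
Lemma gale2P k (S : {set 'I_k}) : gale 2 S ->
  exists2 s : nat, (s < k)%N & forall i : 'I_k,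
    (i \in S) = [|| i == s :> nat, i == s.+1 :> nat | (i == 0 :> nat) && (s == k.-1)].
Proof.
case/andP => /cards2P[x [y [xy ->]]] galeS.
wlog lt_xy : x y xy galeS / (x < y)%N.
  move=> th; case: (ltngtP x y) => [|yx|/val_inj]; [exact: th| |].
    by rewrite finset.setUC; apply: th => //; rewrite 1?eq_sym// finset.setUC.
  by move/eqP; rewrite (negPf xy).
have G (i j : nat) : (i < j)%N -> (j < k)%N -> i != x -> i != y -> j != x -> j != y ->
    ~~ odd ((i < x < j) + (i < y < j))%N.
  move=> ij jk ix iy jx jy; have ik := ltn_trans ij jk.
  have /forallP/(_ (Ordinal jk))/implyP := forallP galeS (Ordinal ik).
  rewrite !inE -!(inj_eq val_inj) /= !negb_or ix iy jx jy ij => /(_ isT).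
  by rewrite cardsE_sum big_setU1 ?inE// big_set1.
have xk := ltn_ord x; have yk := ltn_ord y.
have [yx|yx] := eqVneq (nat_of_ord y) x.+1.
  exists x => // i; rewrite !inE -!(inj_eq val_inj) /= yx.
  have := ltn_ord i; lia.
have x0 : x = 0 :> nat.
  case: (posnP x) => // x_gt0; have := G 0 x.+1; rewrite ltnSn x_gt0 /=; lia.
have yk1 : y = k.-1 :> nat.
  apply/eqP; apply: contraT => yk1; have := G x.+1 k.-1; lia.
exists y => // i; rewrite !inE -!(inj_eq val_inj) /= x0 yk1; have := ltn_ord i; lia.
Qed.

(** A facet is a pair of consecutive labels with an end label, 0 if [e] holds and [k.-1] otherwise;
    the second clause keeps the end label out of the pair. *)
Lemma gale3P k (S : {set 'I_k}) : gale 3 S ->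
  exists (s : nat) (e : bool), [/\ (s.+1 < k)%N,
    (if e then 0 < s else s.+2 < k)%N & forall i : 'I_k,
    (i \in S) = [|| i == s :> nat, i == s.+1 :> nat | i == (if e then 0 else k.-1) :> nat]].
Proof.
case/andP => /eqP S3 galeS.
have /card_gt0P[x0 x0S] : (0 < #|S|)%N by rewrite S3.
have [a /= aS a_min] := @arg_minnP _ x0 [in S] (@nat_of_ord k) x0S.
have : #|S :\ a| == 2 by move: S3; rewrite (cardsD1 a) aS add1n => /eq_add_S/eqP.
case/cards2P => [x [y [xy Sxy]]].
wlog lt_xy : x y xy Sxy / (x < y)%N.
  move=> th; case: (ltngtP x y) => [|yx|/val_inj]; [exact: th| |].
    by apply: (th y x); rewrite 1?eq_sym// finset.setUC.
  by move/eqP; rewrite (negPf xy).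
have lt_ax : (a < x)%N.
  have : x \in S :\ a by rewrite Sxy !inE eqxx.
  rewrite in_setD1 -(inj_eq val_inj) /= => /andP[xa /a_min]; lia.
have SE : S = a |: (x |: [set y]%SET) by rewrite -Sxy finset.setD1K.
have inS (i : 'I_k) : (i \in S) = [|| i == a :> nat, i == x :> nat | i == y :> nat].
  by rewrite SE !inE.
have G (i j : nat) : (i < j)%N -> (j < k)%N ->
    [&& i != a, i != x & i != y] -> [&& j != a, j != x & j != y] ->
    ~~ odd ((i < a < j) + ((i < x < j) + (i < y < j)))%N.
  move=> ij jk ix jx; have ik := ltn_trans ij jk.
  have /forallP/(_ (Ordinal jk))/implyP := forallP galeS (Ordinal ik).
  rewrite !inS /= !negb_or ix jx ij => /(_ isT).
  rewrite cardsE_sum SE !big_setU1 ?big_set1 ?inE// negb_or -!(inj_eq val_inj) /=.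
  lia.
have [xk yk] := (ltn_ord x, ltn_ord y).
have [[a0 yx]|nyx] : (a = 0 :> nat /\ y = x.+1 :> nat) \/
    ((0 < a) || (x.+1 < y))%N by lia.
  exists x, true; split=> [||i]; rewrite ?inS; lia.
have c1 : (0 < a)%N -> (a.+1 < x)%N -> False by have := G 0 a.+1; lia.
have c2 : (0 < a)%N -> (y.+1 < k)%N -> False by have := G 0 y.+1; lia.
have c3 : (x.+1 < y)%N -> (a.+1 < x)%N -> False by have := G a.+1 x.+1; lia.
have c4 : (x.+1 < y)%N -> (y.+1 < k)%N -> False by have := G x.+1 y.+1; lia.
have [xa yk1] : x = a.+1 :> nat /\ y = k.-1 :> nat by clear G; lia.
exists a, false; split=> [||i]; rewrite ?inS; lia.
Qed.

(** No integer lies strictly between the roots -1 and 0. Up to a positive factor, this is the slack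
    of the vertex [s] at an ordinary facet [i], with [z = s - i]. *)
Lemma consecutive_sign (R : numDomainType) (z : int) :
  (0 : R) <= z%:~R * (z%:~R + 1) ?= iff (z == 0) || (z == -1).
Proof.
rewrite -[1]/(1%:~R) -intrD -intrM; split; first by rewrite ler0z; nia.
by rewrite eq_sym intr_eq0 mulf_eq0 addr_eq0.
Qed.

Lemma leif_pos_scale (R : numFieldType) (x y a c : R) (C : bool) :
  0 < c -> y - x = c * a -> 0 <= a ?= iff C -> x <= y ?= iff C.
Proof.
move=> c0 e [a0 aC]; split; first by rewrite -subr_ge0 e mulr_ge0// ltW.
by rewrite eq_sym -subr_eq0 e mulf_eq0 gt_eqF//= eq_sym.
Qed.

Lemma inscribable_dual_polygon (R : realType) k (t : 'I_k -> R) :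
  {mono t : i j / (i < j)%N >-> i < j} -> (2 < k)%N ->
  inscribable R 2 (dual_type (conv_hull (range (fun j => moment_curve 2 (t j))))).
Proof.
move=> t_lt k2.
(* In the rational parametrization of the circle, [u i] and [v i] are the parameters of the ends of
   the edge [i]. The edge 0 closes the polygon from 0 to [k - 1], and [e] reverses its side. *)
pose u (i : 'I_k) : R := if i == 0 :> nat then 0 else i%:R - 1.
pose v (i : 'I_k) : R := if i == 0 :> nat then k%:R - 1 else i%:R.
pose e (i : 'I_k) : R := if i == 0 :> nat then -1 else 1.
apply: (inscribable_dual_cyclic
  (n := fun i => \row_l [:: e i * (1 - u i * v i); e i * (u i + v i)]`_l)
  (b := fun i => e i * (1 + u i * v i)) (c := 0) (r := 1)) => // S /gale2P[s sk sS].
have D0 : 0 < 1 + s%:R ^+ 2 :> R by rewrite ltr_pwDl// sqr_ge0.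
have D_neq0 : 1 + s%:R ^+ 2 != 0 :> R by rewrite gt_eqF.
exists (\row_l [:: (1 - s%:R ^+ 2) / (1 + s%:R ^+ 2); 2 * s%:R / (1 + s%:R ^+ 2)]`_l).
  by rewrite /sphere /= /dotv !big_ord_recr big_ord0 !mxE /=; field.
move=> i; apply: (@leif_pos_scale _ _ _ (e i * (s%:R - u i) * (s%:R - v i)) (2 / (1 + s%:R ^+ 2))).
- by rewrite divr_gt0.
- by rewrite /dotv !big_ord_recr big_ord0 !mxE /=; field.
have ik := ltn_ord i; rewrite sS /e /u /v; have [i0|i0] := eqVneq (nat_of_ord i) 0.
  have -> : -1 * (s%:R - 0) * (s%:R - (k%:R - 1)) = (s * (k.-1 - s))%:R :> R.
    by rewrite natrM natrB ?predn_sub -?subn1 ?natrB; [ring | lia | lia].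
  rewrite i0; split; first by rewrite ler0n.
  by rewrite eq_sym pnatr_eq0 muln_eq0; lia.
have -> : 1 * (s%:R - (i%:R - 1)) * (s%:R - i%:R) =
    (s%:Z - i%:Z)%:~R * ((s%:Z - i%:Z)%:~R + 1) :> R by rewrite rmorphB /=; ring.
have := consecutive_sign R (s%:Z - i%:Z).
by congr (_ <= _ ?= iff _); lia.
Qed.

Lemma inscribable_dual_wedge (R : realType) k (t : 'I_k -> R) :
  {mono t : i j / (i < j)%N >-> i < j} -> (3 < k)%N ->
  inscribable R 3 (dual_type (conv_hull (range (fun j => moment_curve 3 (t j))))).
Proof.
move=> t_lt k3; pose m : R := k%:R - 2.
have m_gt0 : 0 < m by rewrite subr_gt0 ltr_nat ltnW.
pose n (i : 'I_k) : seq R := if i == 0 :> nat then [:: -1; 1; 0]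
  else if i == k.-1 :> nat then [:: -1; -1; 0] else
  [:: 2 * ((i%:R - 1) * (m - i%:R) + i%:R * (m - i%:R + 1)); 0;
      2 * i%:R * (i%:R - 1) - (m - i%:R) * (m - i%:R + 1)].
pose b (i : 'I_k) : R := if (i == 0 :> nat) || (i == k.-1 :> nat) then 0
  else 2 * i%:R * (i%:R - 1) + (m - i%:R) * (m - i%:R + 1).
apply: (inscribable_dual_cyclic (n := fun i => \row_l (n i)`_l) (b := b) (c := 0) (r := 1)) => //.
move=> S /gale3P[s [e [sk se sS]]].
(* A vertex has a level [s] and a sign [y]. The polygons 0 and [k.-1] lie in the planes where the
   second coordinate is plus or minus the first and share the poles, where [p * q = 0]; any other
   facet [i] joins the levels [i - 1] and [i]. The coefficient 2 of [p ^+ 2] is [1 + y ^+ 2], which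
   puts the points on the unit sphere. *)
pose p : R := s%:R; pose q : R := m - s%:R; pose y : R := if e then 1 else -1.
have p0 : 0 <= p by rewrite ler0n.
have q0 : 0 <= q by rewrite subr_ge0 /m lerBrDr -natrD ler_nat addn2.
have pq_m : p + q = m by rewrite addrC subrK.
have D0 : 0 < 2 * p ^+ 2 + q ^+ 2.
  have [q_eq0|q_neq0] := eqVneq q 0.
    by rewrite q_eq0 expr0n addr0 mulr_gt0// exprn_gt0//; move: pq_m; rewrite q_eq0 addr0 => ->.
  by rewrite ltr_wpDl ?mulr_ge0 ?sqr_ge0// exprn_even_gt0.
have D_neq0 : 2 * p ^+ 2 + q ^+ 2 != 0 by rewrite gt_eqF.
have y2 : y ^+ 2 = 1 by rewrite /y; case: (e); ring.
exists (\row_l [:: 2 * p * q / (2 * p ^+ 2 + q ^+ 2);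
                  y * (2 * p * q) / (2 * p ^+ 2 + q ^+ 2);
                  (2 * p ^+ 2 - q ^+ 2) / (2 * p ^+ 2 + q ^+ 2)]`_l).
  rewrite /sphere /= /dotv !big_ord_recr big_ord0 !mxE /=.
  transitivity ((4 * p ^+ 2 * q ^+ 2 * (1 + y ^+ 2) + (2 * p ^+ 2 - q ^+ 2) ^+ 2)
     / (2 * p ^+ 2 + q ^+ 2) ^+ 2); first by field.
  by rewrite y2; field.
move=> i; have ik := ltn_ord i.
have pq0 : p * q = (s * (k - 2 - s))%:R.
  by rewrite natrM !natrB; [| lia | lia].
have pqP : 0 <= p * q ?= iff ((s == 0) || (s.+2 == k)).
  by rewrite pq0; split; rewrite ?ler0n// eq_sym pnatr_eq0 muln_eq0; lia.
have zero_leif : 0 <= 0 ?= iff true :> R by split; rewrite ?lexx ?eqxx.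
have [i0|i0] := eqVneq (nat_of_ord i) 0.
  apply: (@leif_pos_scale _ _ _ ((1 - y) * (p * q)) (2 / (2 * p ^+ 2 + q ^+ 2))).
  - by rewrite divr_gt0.
  - by rewrite /n /b i0 eqxx /dotv !big_ord_recr big_ord0 !mxE /=; field.
  rewrite sS i0 /y; move: se; case: (e) => se; first by rewrite subrr mul0r !orbT.
  split; first by rewrite opprK mulr_ge0// pqP.
  by rewrite eq_sym opprK mulf_eq0 gt_eqF//= eq_sym pqP; lia.
have [i1|i1] := eqVneq (nat_of_ord i) k.-1.
  apply: (@leif_pos_scale _ _ _ ((1 + y) * (p * q)) (2 / (2 * p ^+ 2 + q ^+ 2))).
  - by rewrite divr_gt0.
  - rewrite /n /b (negPf i0) i1 eqxx orbT /dotv !big_ord_recr big_ord0 !mxE /=.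
    by field.
  rewrite sS i1 /y; move: se; case: (e) => se; last by rewrite subrr mul0r eqxx !orbT.
  split; first by rewrite mulr_ge0// pqP.
  by rewrite eq_sym mulf_eq0 gt_eqF//= eq_sym pqP; lia.
apply: (@leif_pos_scale _ _ _ ((p - i%:R) * (p - i%:R + 1))
  (4 * m ^+ 2 / (2 * p ^+ 2 + q ^+ 2))).
- by rewrite divr_gt0// mulr_gt0// exprn_gt0.
- rewrite /n /b (negPf i0) (negPf i1) /dotv !big_ord_recr big_ord0 !mxE /= -pq_m.
  by field.
have -> : p - i%:R = (s%:Z - i%:Z)%:~R by rewrite rmorphB.
have := consecutive_sign R (s%:Z - i%:Z).
by rewrite sS; congr (_ <= _ ?= iff _); case: (e) se; lia.
Qed.

(* Here [cl] partitions the facets into the facet sets of the factors of a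
   product of simplices, and the last facet of each factor is the one that does
   not contain the origin. *)
Lemma inscribable_dual_product (R : realType) d k (t : 'I_k -> R) (cl : nat -> nat) :
  {mono t : i j / (i < j)%N >-> i < j} -> (d < k)%N -> (0 < d)%N ->
  (forall i j, (d <= i < k)%N -> (d <= j < k)%N -> cl i = cl j -> i = j) ->
  (forall (S : {set 'I_k}), gale d S -> forall i, exists e : 'I_k,
     forall l : 'I_k, (l \notin S) && (cl l == cl i) = (l == e)) ->
  inscribable R d (dual_type (conv_hull (range (fun j => moment_curve d (t j))))).
Proof.
move=> t_lt d_lt_k d_gt0 cl_inj clP; pose w := widen_ord (ltnW d_lt_k).
have w_inj : injective w by move=> l l' /(congr1 val) /= ll'; exact: val_inj.
(* For [i < d] the facet is a coordinate hyperplane; otherwise it bounds by 1 the sum of the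
   coordinates in the class of [i]. *)
pose n (i : 'I_k) : 'rV[R]_d := if (i < d)%N then \row_l - (w l == i)%:R
  else \row_l (cl l == cl i)%:R.
apply: (inscribable_dual_cyclic (n := n) (b := fun i => (d <= i)%:R)
  (c := const_mx 2^-1) (r := Num.sqrt d%:R / 2)) => // [|S gS].
  by rewrite divr_gt0// sqrtr_gt0 ltr0n.
exists (\row_l (w l \notin S)%:R).
  rewrite /sphere /= /dotv expr_div_n sqr_sqrtr ?ler0n//.
  rewrite (eq_bigr (fun=> 2^-1 ^+ 2)) => [|l _].
    by rewrite sumr_const card_ord -[_ *+ _]mulr_natr; field.
  by rewrite !mxE; case: (_ \notin _) => /=; field.
move=> i; rewrite /n; case: (ltnP i d) => [id_|di].
  have -> : dotv (\row_l - (w l == i)%:R) (\row_l (w l \notin S)%:R) = - (i \notin S)%:R :> R.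
    have wi : w (Ordinal id_) = i by exact: val_inj.
    rewrite /dotv (bigD1 (Ordinal id_))//= !mxE wi eqxx mulN1r big1 ?addr0// => l li.
    by rewrite !mxE -wi (inj_eq w_inj) (negPf li) oppr0 mul0r.
  split; first by rewrite oppr_le0.
  by rewrite oppr_eq0; case: (i \in S); rewrite ?eqxx ?oner_eq0.
(* [e] is the only facet of this factor that misses the vertex, so the sum of the coordinates is 1
   unless [e] is [i] itself. *)
have [e eP] := clP S gS i.
have -> : dotv (\row_l (cl l == cl i)%:R) (\row_l (w l \notin S)%:R) = (e < d)%:R :> R.
  rewrite /dotv (eq_bigr (fun l => (w l == e)%:R)) => [|l _]; last first.
    by rewrite !mxE mulrC -natrM mulnb eP.
  case: (ltnP e d) => [ed|de].
    have we : w (Ordinal ed) = e by exact: val_inj.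
    rewrite (bigD1 (Ordinal ed))//= we eqxx big1 ?addr0// => l le.
    by rewrite -we (inj_eq w_inj) (negPf le).
  rewrite big1// => l _; case: eqP => // wle.
  by have := ltn_ord l; rewrite ltnNge -[X in (_ <= X)%N]/(nat_of_ord (w l)) wle de.
have e_in : (i \in S) = (e < d)%N.
  have /andP[eS /eqP cle] : (e \notin S) && (cl e == cl i) by rewrite eP.
  apply/idP/idP => [iS|ed].
    rewrite ltnNge; apply: contraL iS => de.
    by rewrite (_ : i = e)//; apply/val_inj/cl_inj => //; rewrite ltn_ord ?andbT.
  have ie : (i == e) = false by apply: contraTF ed => /eqP <-; rewrite -leqNgt.
  by have := eP i; rewrite ie eqxx andbT => /negbFE.
rewrite e_in; case: (e < d)%N; split; rewrite ?ler01 ?lexx ?eqxx//.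
by rewrite eq_sym oner_eq0.
Qed.

Lemma sum_between (i j k : nat) :
  (\sum_(l < k) (i < l < j) = minn k j - i.+1)%N.
Proof. by elim: k => [|k IHk]; rewrite ?big_ord0 ?min0n// big_ord_recr /= IHk; lia. Qed.

Lemma inscribable_dual_simplex (R : realType) d k (t : 'I_k -> R) :
  {mono t : i j / (i < j)%N >-> i < j} -> (0 < d)%N -> k = d.+1 ->
  inscribable R d (dual_type (conv_hull (range (fun j => moment_curve d (t j))))).
Proof.
move=> t_lt d_gt0 kd; apply: (@inscribable_dual_product R d k t (fun=> 0%N)) => //.
- by rewrite kd.
- by move=> i j; lia.
move=> S /andP[/eqP Sd _] i.
have /cards1P[e eE] : #|~: S| == 1 by rewrite cardsCs finset.setCK card_ord Sd; lia.
by exists e => l; rewrite andbT -finset.in_setC eE finset.in_set1.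
Qed.

(** The two labels missing from [S] enclose an even number of labels, all in [S], so they have
    opposite parity: each parity class contains exactly one of them. *)
Lemma inscribable_dual_two_simplices (R : realType) d k (t : 'I_k -> R) :
  {mono t : i j / (i < j)%N >-> i < j} -> (0 < d)%N -> k = d.+2 ->
  inscribable R d (dual_type (conv_hull (range (fun j => moment_curve d (t j))))).
Proof.
move=> t_lt d_gt0 kd; apply: (@inscribable_dual_product R d k t (fun i => odd i)) => //.
- by rewrite kd; lia.
- by move=> i j; lia.
move=> S /andP[/eqP Sd galeS] i.
have /cards2P[x [y [xy xyE]]] : #|~: S| == 2 by rewrite cardsCs finset.setCK card_ord Sd; lia.
wlog lt_xy : x y xy xyE / (x < y)%N.
  move=> th; case: (ltngtP x y) => [|yx|/val_inj]; [exact: th| |].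
    by apply: (th y x); rewrite 1?eq_sym// finset.setUC.
  by move/eqP; rewrite (negPf xy).
have inS l : (l \notin S) = (l == x) || (l == y) by rewrite -finset.in_setC xyE finset.in_set2.
have odd_xy : odd x != odd y.
  have /forallP/(_ y) := forallP galeS x; rewrite !inS !eqxx orbT lt_xy /= cardsE_sum.
  have -> : (\sum_(s in S) (x < s < y) = \sum_(s < k) (x < s < y))%N.
    rewrite [RHS](bigID [in S]) /= [X in (_ = _ + X)%N]big1 ?addn0// => l.
    by rewrite inS => /orP[]/eqP ->; lia.
  by rewrite sum_between; have := ltn_ord y; lia.
exists (if odd x == odd i then x else y) => l; rewrite inS.
case: ifP => xi; have [->|lx] := eqVneq l x; have [ly|ly] := eqVneq l y => //=;
  rewrite ?ly; move: xi odd_xy; rewrite ?(negPf xy) ?(eq_sym y x) ?(negPf xy); lia.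
Qed.

(** * The dual of the cyclic 4-polytope on 7 vertices *)

Definition gale_bits (s : bitseq) : bool :=
  (sumn (map nat_of_bool s) == 4) && all (fun i => all (fun j =>
    [&& ~~ nth false s i, ~~ nth false s j & (i < j)%N] ==>
      ~~ odd (sumn [seq (nth false s l && (i < l < j)%N : nat) | l <- iota 0 7]))
    (iota 0 7)) (iota 0 7).

Definition bits (S : {set 'I_7}) : bitseq := [seq i \in S | i <- enum 'I_7].

Lemma nth_bits (S : {set 'I_7}) (i : 'I_7) : nth false (bits S) i = (i \in S).
Proof. by rewrite (nth_map i) ?size_enum_ord// nth_ord_enum. Qed.

Lemma gale_gale_bits (S : {set 'I_7}) : gale 4 S -> gale_bits (bits S).
Proof.
case/andP => S4 galeS; apply/andP; split.
  suff -> : sumn (map nat_of_bool (bits S)) = #|S| by [].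
  rewrite sumnE 2!big_map big_enum -sum1_card [RHS]big_mkcond /=.
  by apply: eq_bigr => i _; case: (i \in S).
apply/allP => i; rewrite mem_iota => ik; apply/allP => j; rewrite mem_iota => jk.
have := forallP (forallP galeS (Ordinal ik)) (Ordinal jk).
rewrite -!nth_bits; congr (_ ==> ~~ odd _).
rewrite -sum1_card big_mkcond sumnE big_map -[iota 0 7]/(index_iota 0 7) big_mkord.
by apply: eq_bigr => l _; rewrite finset.in_set nth_bits; case: ifP.
Qed.

(* The data come from an inversion at the vertex [{0,1,3,4}]: the remaining
   vertices then lie on four planes bounding a tetrahedron with a rotational
   symmetry of order two and on three spheres. A row [(fs, x, m)] is the vertex
   [x_l / m] on the facets [fs], in the coordinates where the unit sphere is
   [x_0 ^ 2 + 11 x_1 ^ 2 + 21 x_2 ^ 2 + x_3 ^ 2 = 1]. *)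
Definition weights47 : seq int := [:: 1; 11; 21; 1].

Definition vertices47 : seq (seq nat * seq int * int) :=
  [:: ([:: 0; 1; 2; 3]%N, [:: 1; 0; 0; 0], 1);
      ([:: 0; 1; 2; 6]%N, [:: 5; 1; 2; -1], 11);
      ([:: 0; 1; 3; 4]%N, [:: 0; 0; 0; 1], 1);
      ([:: 0; 1; 4; 5]%N, [:: -1; 1; 2; 5], 11);
      ([:: 0; 1; 5; 6]%N, [:: 2; 1; 2; 1], 10);
      ([:: 0; 2; 3; 6]%N, [:: 10; -1; 2; -1], 14);
      ([:: 0; 3; 4; 6]%N, [:: 1; -1; 2; 5], 11);
      ([:: 0; 4; 5; 6]%N, [:: 0; 0; 1; 2], 5);
      ([:: 1; 2; 3; 4]%N, [:: -1; 0; 0; 0], 1);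
      ([:: 1; 2; 4; 5]%N, [:: -10; 1; 2; -1], 14);
      ([:: 1; 2; 5; 6]%N, [:: 2; 1; 2; -1], 10);
      ([:: 2; 3; 4; 5]%N, [:: -5; -1; 2; -1], 11);
      ([:: 2; 3; 5; 6]%N, [:: -2; -1; 2; -1], 10);
      ([:: 3; 4; 5; 6]%N, [:: -2; -1; 2; 1], 10)].

Definition facets47 : seq (seq int * int) :=
  [:: ([:: 77; 7; 11; 77], 77); ([:: 0; 42; -11; 0], 0);
      ([:: 0; 0; -1; -42], 0); ([:: 0; -42; -11; 0], 0);
      ([:: -77; -7; 11; 77], 77); ([:: -77; 14; 55; 0], 231);
      ([:: 77; -14; 55; 0], 231)].

Definition wdot (x y : seq int) : int :=
  let w := weights47 in
  w`_0 * (x`_0 * y`_0) + w`_1 * (x`_1 * y`_1) + w`_2 * (x`_2 * y`_2) + w`_3 * (x`_3 * y`_3).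

Definition check_vertex (v : seq nat * seq int * int) : bool :=
  let: (fs, x, m) := v in
  [&& 0 < m, wdot x x == m ^+ 2 & all (fun i =>
    let: (n, b) := nth ([::], 0) facets47 i in
    (0 <= b * m - wdot n x) && ((0 == b * m - wdot n x) == (i \in fs))) (iota 0 7)].

Lemma check_vertices47 : all check_vertex vertices47.
Proof. by vm_compute. Qed.

Lemma gale_bits_vertex s : size s = 7%N -> gale_bits s ->
  has (fun v => s == [seq i \in v.1.1 | i <- iota 0 7]) vertices47.
Proof.
by case: s => [|[] [|[] [|[] [|[] [|[] [|[] [|[] [|]]]]]]]]//= _; vm_compute.
Qed.

Lemma inscribable_dual_cyclic47 (R : realType) (t : 'I_7 -> R) :
  {mono t : i j / (i < j)%N >-> i < j} ->
  inscribable R 4 (dual_type (conv_hull (range (fun j => moment_curve 4 (t j))))).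
Proof.
(* Scaling the coordinates by the square roots of the weights turns [wdot] into the Euclidean
   product. *)
move=> t_lt; pose c l : R := Num.sqrt (weights47`_l)%:~R.
pose vec (x : seq int) : 'rV[R]_4 := \row_l (c l * (x`_l)%:~R).
have vecE x y : dotv (vec x) (vec y) = (wdot x y)%:~R.
  have cc l (a b : R) : (l < 4)%N -> c l * a * (c l * b) = (weights47`_l)%:~R * (a * b).
    move=> l4; rewrite mulrACA -expr2 sqr_sqrtr// ler0z.
    by case: l l4 => [|[|[|[|]]]].
  rewrite /dotv !big_ord_recr big_ord0 !mxE /= add0r.
  by rewrite !cc// /wdot !rmorphD !rmorphM.
apply: (inscribable_dual_cyclic
  (n := fun i : 'I_7 => vec (nth ([::], 0) facets47 i).1)
  (b := fun i : 'I_7 => (nth ([::], 0) facets47 i).2%:~R) (c := 0) (r := 1)) => // S gS.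
have /hasP[[[fs x] m] vT /eqP SI] :
    has (fun v => bits S == [seq i \in v.1.1 | i <- iota 0 7]) vertices47.
  apply: gale_bits_vertex (gale_gale_bits gS).
  by rewrite size_map size_enum_ord.
have /and3P[m_gt0 /eqP xx /allP facets] := allP check_vertices47 _ vT.
have m0 : 0 < m%:~R :> R by rewrite ltr0z.
exists (m%:~R^-1 *: vec x).
  rewrite /sphere /= subr0 dotvZl dotvZr vecE xx rmorphXn /=; field.
  by rewrite gt_eqF.
move=> i; have -> : (i \in S) = (nat_of_ord i \in fs).
  by rewrite -nth_bits SI (nth_map 0%N) ?size_iota// nth_iota.
have := facets i; rewrite mem_iota ltn_ord => /(_ isT).
case: (nth _ _ _) => n b /=.
move=> /andP[ge0 /eqP eq0].
apply: (@leif_pos_scale _ _ _ (b * m - wdot n x)%:~R m%:~R^-1).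
- by rewrite invr_gt0.
- by rewrite dotvZr vecE rmorphB rmorphM /=; field; rewrite gt_eqF.
by split; [rewrite ler0z | rewrite eq_sym intr_eq0 eq_sym].
Qed.

(** * The obstruction *)

Section MiquelObstruction.
Variables (R : realFieldType) (N : nat).
Implicit Types x y z w : 'rV[R]_N.

(** For points of a sphere in homogeneous coordinates, dependence means that the four points lie in
    a plane, hence on a circle. *)
Definition free4 x y z w : Prop := forall a b c e : R,
  a *: x + b *: y + c *: z + e *: w = 0 -> [/\ a = 0, b = 0, c = 0 & e = 0].

Lemma free4_swap x y z w : free4 x y z w -> free4 x z y w.
Proof. by move=> f a b c e; rewrite [_ + b *: _ + _]addrAC => /f[]. Qed.

Lemma free4_swapr x y z w : free4 x y z w -> free4 x y w z.
Proof. by move=> f a b c e; rewrite addrAC => /f[]. Qed.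

Variable B : 'rV[R]_N -> 'rV[R]_N -> R.
Hypothesis B_sym : forall x y, B x y = B y x.
Hypothesis B_add : forall x y z, B (x + y) z = B x z + B y z.
Hypothesis B_scale : forall a x y, B (a *: x) y = a * B x y.

Variable v : 'rV[R]_N.
Hypothesis vv : B v v = 0.

(** For the form of a sphere and this scaling, [B x y] is, up to a constant factor, the squared
    distance of the images of [x] and [y] under inversion at [v]. *)
Definition normal_null x : Prop := B x x = 0 /\ B v x = 1.

(* The null vectors normalized against [v] in the span of [v], [y] and [t];
   sending [v] to infinity makes this the line through [y] and [t]. *)
Definition null_line y t (s : R) : 'rV[R]_N :=
  (1 - s) *: y + s *: t - (s * (1 - s) * B y t) *: v.

Lemma null_lineC y t s : null_line y t s = null_line t y (1 - s).
Proof.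
by rewrite /null_line subKr [_ *: y + _]addrC (B_sym t) [_ * s]mulrC.
Qed.

(** The vector [x] certifies that [v], [y], [t] are independent, so the relation can be solved for
    [w]. Then [B v w = 1] makes the coefficients of [y] and [t] sum to 1, and [B w w = 0] fixes that
    of [v]. *)
Lemma null_lineP y t w : normal_null y -> normal_null t -> normal_null w ->
  (exists x, free4 v y t x) -> ~ free4 v y t w -> exists s, w = null_line y t s.
Proof.
move=> [yy vy] [tt vt] [ww vw] [x vytx] nf.
have [e [a [b [c [e0 nz]]]]] : exists e a b c : R,
    e *: v + a *: y + b *: t + c *: w = 0 /\ ~ [/\ e = 0, a = 0, b = 0 & c = 0].
  apply: contrapT => no; apply: nf => e a b c e0; apply: contrapT => nz.
  by apply: no; exists e, a, b, c.
have c0 : c != 0.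
  apply/eqP => c0; apply: nz; have [|-> -> -> _] := vytx e a b 0; last by [].
  by move: e0; rewrite c0 !scale0r.
have [e' [a' [b' wE]]] : exists e' a' b', w = a' *: y + b' *: t + e' *: v.
  exists (- (c^-1 * e)), (- (c^-1 * a)), (- (c^-1 * b)).
  have : c *: w = - (e *: v + a *: y + b *: t) by apply/eqP; rewrite -addr_eq0 addrC e0.
  move/(congr1 (fun z => c^-1 *: z)); rewrite scalerA mulVf// scale1r => ->.
  by apply/rowP => j; rewrite !mxE; ring.
have Bw z : B w z = a' * B y z + b' * B t z + e' * B v z.
  by rewrite wE !B_add !B_scale.
have ab : a' + b' = 1.
  by move: vw; rewrite B_sym Bw B_sym vy B_sym vt vv; lra.
have e'E : e' = - (a' * b' * B y t).
  move: ww; rewrite Bw (B_sym y w) (B_sym t w) (B_sym v w) !Bw yy tt vv.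
  rewrite (B_sym t y) (B_sym y v) (B_sym t v) vy vt; nra.
have a'E : a' = 1 - b' by lra.
by exists b'; rewrite wE /null_line e'E a'E; apply/rowP => j; rewrite !mxE; ring.
Qed.

(* The power of the point [y] with respect to a circle that meets the lines
   [y t] and [y Y] in [s1], [s2] and in [l], [Y]. *)
Lemma power_of_point y t Y s1 s2 l :
  free4 v y t Y -> s1 != s2 -> l != 1 ->
  ~ free4 (null_line y t s1) (null_line y t s2) (null_line y Y l) Y ->
  l * B y Y = s1 * s2 * B y t.
Proof.
move=> f s12 l1 nf; apply/eqP; apply: contraT => ne; case: nf => c1 c2 c3 c4 h.
have [] := f (- (c1 * (s1 * (1 - s1) * B y t) + c2 * (s2 * (1 - s2) * B y t)
     + c3 * (l * (1 - l) * B y Y)))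
  (c1 * (1 - s1) + c2 * (1 - s2) + c3 * (1 - l)) (c1 * s1 + c2 * s2) (c3 * l + c4).
  by rewrite -h; apply/rowP => j; rewrite /null_line !mxE; ring.
move=> ev ey et eY.
(* Eliminating [c1] and [c2] from the coefficient of [v] leaves the difference of the two powers,
   nonzero by assumption, so [c3 = 0]. *)
have : c3 * (1 - l) * (l * B y Y - s1 * s2 * B y t) = 0.
  have e1 : c1 + c2 = - (c3 * (1 - l)) by lra.
  have : - (c1 * (s1 * (1 - s1) * B y t) + c2 * (s2 * (1 - s2) * B y t)
     + c3 * (l * (1 - l) * B y Y)) =
     - (c1 * s1 + c2 * s2) * B y t * (1 - s1 - s2)
     - (c1 + c2) * (s1 * s2 * B y t) - c3 * (1 - l) * (l * B y Y) by ring.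
  rewrite ev et e1; lra.
move/eqP; rewrite !mulf_eq0 !subr_eq0 (negPf ne) [1 == _]eq_sym (negPf l1) !orbF => /eqP c30.
have c12 : c1 = - c2 by move: ey; rewrite c30; lra.
have c20 : c2 = 0.
  move: et; rewrite c12 mulNr addrC -mulrBr => /eqP.
  by rewrite mulf_eq0 subr_eq0 [s2 == _]eq_sym (negPf s12) orbF => /eqP.
by move: eY; rewrite c12 c20 c30 oppr0 mul0r add0r.
Qed.

Lemma B_null_line y t s x :
  B (null_line y t s) x = (1 - s) * B y x + s * B t x - s * (1 - s) * B y t * B v x.
Proof. by rewrite /null_line !B_add -scaleNr !B_scale mulNr. Qed.

Lemma null_line0 y t : null_line y t 0 = y.
Proof. by rewrite /null_line subr0 scale1r scale0r !mul0r scale0r addr0 subr0. Qed.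

Lemma null_line1 y t : null_line y t 1 = t.
Proof. by rewrite null_lineC subrr null_line0. Qed.

(** The powers at the two ends of a cross edge, such as [l1 * B y Y] at [y] and [(1 - l1) * B y Y]
    at [Y], add up to its squared length. Once the four lengths are so expressed by the positions on
    the two lines, the squared distance of the points [s2] and [u2] vanishes identically. *)
Lemma null_line_orthogonal y t Y T s1 s2 s3 u1 u2 u3 l1 l2 l3 l4 :
  normal_null y -> normal_null t -> normal_null Y -> normal_null T ->
  l1 * B y Y = s1 * s2 * B y t ->
  l2 * B t Y = (1 - s1) * (1 - s2) * B y t ->
  l3 * B y T = s2 * s3 * B y t ->
  l4 * B t T = (1 - s2) * (1 - s3) * B y t ->
  (1 - l1) * B y Y = u1 * u2 * B Y T ->
  (1 - l3) * B y T = (1 - u1) * (1 - u2) * B Y T ->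
  (1 - l2) * B t Y = u2 * u3 * B Y T ->
  (1 - l4) * B t T = (1 - u2) * (1 - u3) * B Y T ->
  B (null_line y t s2) (null_line Y T u2) = 0.
Proof.
move=> [_ vy] [_ vt] [_ vY] [_ vT] e1 e2 e3 e4 f1 f3 f2 f4.
have ByY : B y Y = s1 * s2 * B y t + u1 * u2 * B Y T by rewrite -e1 -f1; ring.
have BtY : B t Y = (1 - s1) * (1 - s2) * B y t + u2 * u3 * B Y T.
  by rewrite -e2 -f2; ring.
have ByT : B y T = s2 * s3 * B y t + (1 - u1) * (1 - u2) * B Y T.
  by rewrite -e3 -f3; ring.
have BtT : B t T = (1 - s2) * (1 - s3) * B y t + (1 - u2) * (1 - u3) * B Y T.
  by rewrite -e4 -f4; ring.
have BL z : B z (null_line Y T u2) =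
    (1 - u2) * B z Y + u2 * B z T - u2 * (1 - u2) * B Y T * B z v.
  by rewrite B_sym B_null_line !(B_sym _ z).
by rewrite B_null_line !BL (B_sym y v) (B_sym t v) ByY BtY ByT BtT vv vY vT vy vt; ring.
Qed.


Lemma power_at_end y t Y w1 w2 p s1 s2 l :
  free4 v y t Y -> w1 = null_line y t s1 -> w2 = null_line y t s2 ->
  p = null_line y Y l -> w1 != w2 -> p != Y -> ~ free4 w1 w2 p Y ->
  l * B y Y = s1 * s2 * B y t.
Proof.
move=> f e1 e2 ep w12 pY nf; apply: power_of_point f _ _ _.
- by apply: contra_neq w12 => s12; rewrite e1 e2 s12.
- by apply: contra_neq pY => l1; rewrite ep l1 null_line1.
- by rewrite -e1 -e2 -ep.
Qed.

(** After inversion, [y t] and [Y T] are opposite edges of a tetrahedron, carrying the [w] and the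
    [x], and [p1] to [p4] lie on the other four edges. The last eight dependences give one power
    each. *)
Lemma miquel_obstruction y t Y T p1 p2 p3 p4 w1 w2 w3 x1 x2 x3 :
  {in [:: y; t; Y; T; p1; p2; p3; p4; w1; w2; w3; x1; x2; x3],
    forall z, normal_null z} ->
  free4 v y t Y -> free4 v y t T -> free4 v Y T y -> free4 v Y T t ->
  {in [:: w1; w2; w3], forall w, ~ free4 v y t w} ->
  {in [:: x1; x2; x3], forall x, ~ free4 v Y T x} ->
  ~ free4 v y Y p1 -> ~ free4 v t Y p2 -> ~ free4 v y T p3 -> ~ free4 v t T p4 ->
  ~ free4 w1 w2 p1 Y -> ~ free4 w1 w2 p2 Y ->
  ~ free4 w2 w3 p3 T -> ~ free4 w2 w3 p4 T ->
  ~ free4 x1 x2 p1 y -> ~ free4 x1 x2 p3 y ->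
  ~ free4 x2 x3 p2 t -> ~ free4 x2 x3 p4 t ->
  [&& w1 != w2, w2 != w3, x1 != x2 & x2 != x3] ->
  [&& p1 != y, p1 != Y, p2 != t & p2 != Y] ->
  [&& p3 != y, p3 != T, p4 != t & p4 != T] ->
  B w2 x2 = 0.
Proof.
move=> nn fY fT fy ft wP xP p1P p2P p3P p4P g1 g2 g3 g4 h1 h3 h2 h4.
move=> /and4P[w12 w23 x12 x23] /and4P[p1y p1Y p2t p2Y] /and4P[p3y p3T p4t p4T].
have [ny nt nY nT] : [/\ normal_null y, normal_null t, normal_null Y & normal_null T].
  by split; apply: nn; rewrite !inE eqxx ?orbT.
have [n1 n2 n3 n4] : [/\ normal_null p1, normal_null p2, normal_null p3 & normal_null p4].
  by split; apply: nn; rewrite !inE eqxx ?orbT.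
have wE w : w \in [:: w1; w2; w3] -> exists s, w = null_line y t s.
  move=> w_in; apply: null_lineP (wP _ w_in) => //; last by exists Y.
  by apply: nn; move: w_in; rewrite !inE => /or3P[]/eqP ->; rewrite eqxx ?orbT.
have xE x : x \in [:: x1; x2; x3] -> exists s, x = null_line Y T s.
  move=> x_in; apply: null_lineP (xP _ x_in) => //; last by exists y.
  by apply: nn; move: x_in; rewrite !inE => /or3P[]/eqP ->; rewrite eqxx ?orbT.
have [[s1 e1] [s2 e2] [s3 e3]] :
    [/\ exists s, w1 = null_line y t s, exists s, w2 = null_line y t s
       & exists s, w3 = null_line y t s].
  by split; apply: wE; rewrite !inE eqxx ?orbT.
have [[u1 f1] [u2 f2] [u3 f3]] :
    [/\ exists s, x1 = null_line Y T s, exists s, x2 = null_line Y T s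
       & exists s, x3 = null_line Y T s].
  by split; apply: xE; rewrite !inE eqxx ?orbT.
have [[[fY' fT'] fy'] ft'] := (free4_swap fY, free4_swap fT, free4_swap fy, free4_swap ft).
have [l1 q1] : exists l, p1 = null_line y Y l.
  by apply: null_lineP p1P => //; exists t; exact: free4_swapr.
have [l2 q2] : exists l, p2 = null_line t Y l.
  by apply: null_lineP p2P => //; exists y; exact: free4_swapr.
have [l3 q3] : exists l, p3 = null_line y T l.
  by apply: null_lineP p3P => //; exists t; exact: free4_swapr.
have [l4 q4] : exists l, p4 = null_line t T l.
  by apply: null_lineP p4P => //; exists y; exact: free4_swapr.
rewrite e2 f2; apply: (@null_line_orthogonal y t Y T s1 s2 s3 u1 u2 u3 l1 l2 l3 l4) => //.
- exact: (power_at_end fY e1 e2 q1).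
(* When the power is taken at the other end of a line, [null_lineC] replaces the parameter [s] by
   [1 - s]. *)
- rewrite [B y t]B_sym; apply: (power_at_end fY' _ _ q2 w12) => //; by rewrite -null_lineC.
- exact: (power_at_end fT e2 e3 q3).
- rewrite [B y t]B_sym; apply: (power_at_end fT' _ _ q4 w23) => //; by rewrite -null_lineC.
- by rewrite B_sym; apply: (power_at_end fy f1 f2 _ x12 p1y) => //; rewrite -null_lineC.
- rewrite B_sym [B Y T]B_sym; apply: (power_at_end fy' _ _ _ x12 p3y) => //;
  by rewrite -null_lineC.
- by rewrite B_sym; apply: (power_at_end ft f2 f3 _ x23 p2t) => //; rewrite -null_lineC.
- rewrite B_sym [B Y T]B_sym; apply: (power_at_end ft' _ _ _ x23 p4t) => //;
  by rewrite -null_lineC.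
Qed.

End MiquelObstruction.

(** * Faces of a polytope with the dual face lattice *)

Definition simplex_face (d k : nat) (T : {set 'I_k}) : bool :=
  [exists S, gale d S && (T \subset S)].

Lemma gale_simplex_face d k (S : {set 'I_k}) : gale d S -> simplex_face d S.
Proof. by move=> gS; apply/existsP; exists S; rewrite gS fintype.subxx. Qed.

Lemma simplex_face_sub d k (T T' : {set 'I_k}) :
  T \subset T' -> simplex_face d T' -> simplex_face d T.
Proof.
move=> TT' /existsP[S /andP[gS T'S]]; apply/existsP; exists S.
by rewrite gS (fintype.subset_trans TT').
Qed.

(** All that the obstruction uses of the combinatorial type: an order-reversing embedding of the
    proper faces of the cyclic polytope into the nonempty faces of [Q]. *)
Definition dual_faces (R : realType) (d k : nat) (Q : set 'rV[R]_d)
    (phi : {set 'I_k} -> set 'rV[R]_d) : Prop :=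
  [/\ forall T, simplex_face d T -> face Q (phi T),
      forall T, simplex_face d T -> exists x, phi T x &
      forall T T', simplex_face d T -> simplex_face d T' ->
        (phi T' `<=` phi T)%classic <-> T \subset T'].

Lemma dual_facesP (R : realType) (d k : nat) (t : 'I_k -> R) (Q : set 'rV[R]_d) :
  {mono t : i j / (i < j)%N >-> i < j} -> (d < k)%N ->
  poset_isomorphic (face_lattice Q)
    (dual_type (conv_hull (range (fun j => moment_curve d (t j))))) ->
  exists phi : {set 'I_k} -> set 'rV[R]_d, dual_faces Q phi.
Proof.
move=> t_lt d_lt_k [f [g fK gK] f_mono].
set p := fun j => moment_curve d (t j); set P := conv_hull (range p) in f g fK gK f_mono.
have exG T : exposed p T -> exists G : face_lattice P, face_index p G = T.
  by move=> /exposed_face[G fG GT]; exists (Face (asboolT fG)).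
have [top topT] : exists G : face_lattice P, face_index p G = finset.setT.
  by apply: exG; exists 0, 0 => j; rewrite dot0v finset.in_setT; split; rewrite ?lexx ?eqxx.
have /choice[G GT] (T : {set 'I_k}) : exists G : face_lattice P,
    simplex_face d T -> face_index p G = T.
  have [/existsP[S /andP[gS TS]]|] := boolP (simplex_face d T); last by exists top.
  have [h hT] := gale_sub_supports t_lt d_lt_k gS TS.
  by have [G GT] := exG T (supports_exposed hT); exists G.
have gle (G1 G2 : face_lattice P) :
    (face_set (g G1) `<=` face_set (g G2))%classic <-> face_index p G2 \subset face_index p G1.
  have [f1 f2] : face P G1 /\ face P G2 by split; apply/asboolP/faceP.
  rewrite -(face_subset f2 f1).
  have := f_mono (g G1) (g G2); rewrite !gK leEdual !le_faceE => e.
  by split => h; apply/asboolP; [rewrite e|rewrite -e]; apply/asboolP.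
exists (fun T => face_set (g (G T))); split => [T _|T T_simplex|T T' Ts T's].
- by apply/asboolP/faceP.
(* An empty face would lie below the image of the whole cyclic polytope, and [T] would consist of
   all labels. *)
- apply: contrapT => no.
  have /(gle (G T) top) : (face_set (g (G T)) `<=` face_set (g top))%classic.
    by move=> x Tx; case: no; exists x.
  have /existsP[S /andP[gS TS]] := T_simplex.
  rewrite topT GT// finset.subTset => /eqP TT.
  by have := gale_neqT d_lt_k gS; rewrite -finset.subTset -TT TS.
- by rewrite gle !GT.
Qed.

Section DualFaces.
Variables (R : realType) (d k : nat) (Q : set 'rV[R]_d).
Variable phi : {set 'I_k} -> set 'rV[R]_d.
Hypothesis phiP : dual_faces Q phi.

(** Homogeneous coordinates, in which affine dependence becomes linear. *)
Definition lift_pt (x : 'rV[R]_d) : 'rV[R]_(d + 1) := row_mx x 1%:M.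

Lemma lift_pt_neq0 x : lift_pt x != 0.
Proof.
apply/eqP => /(congr1 rsubmx) /matrixP/(_ 0 0).
by rewrite row_mxKr !mxE eqxx => /eqP; rewrite oner_eq0.
Qed.

Lemma face_functional F : face Q F -> (F `<=` Q)%classic /\
  exists h : 'cV[R]_(d + 1), forall x, Q x -> F x <-> (lift_pt x *m h) 0 0 = 0.
Proof.
move=> [u [b [_ ->]]]; split; first by move=> x [].
exists (col_mx u^T (- b)%:M) => x Qx.
rewrite mul_row_col mul1mx mxE dotvE dotvC mxE eqxx mulr1n.
by split => [[_ /= ->]|/eqP]; rewrite ?subrr// subr_eq0 => /eqP.
Qed.

(** Removing a label from [T] adds a point off the hyperplane that cuts out the old face, so the
    rank grows at each step, and it ends at most at [d + 1]. Multiples of lifted points are allowed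
    because vertices get rescaled later. *)
Lemma face_rank T m (A : 'M[R]_(m, d + 1)) : simplex_face d T ->
  (forall i, exists x a, phi T x /\ row i A = a *: lift_pt x) ->
  (\rank A + #|T| <= d + 1)%N.
Proof.
have [phi_face phi_n0 phi_sub] := phiP.
have [n] := ubnP #|T|; elim: n T m A => // n IHn T m A; rewrite ltnS => Tn Ts AT.
have [->|[i iT]] := set_0Vmem T; first by rewrite cards0 addn0 rank_leq_col.
have T's : simplex_face d (T :\ i) by apply: simplex_face_sub Ts; exact: subD1set.
have [z T'z Tz] : exists2 z, phi (T :\ i) z & ~ phi T z.
  apply: contrapT => no.
  have /(phi_sub _ _ Ts T's) : (phi (T :\ i) `<=` phi T)%classic.
    by move=> z T'z; apply: contrapT => Tz; apply: no; exists z.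
  by move/fintype.subsetP/(_ i iT); rewrite in_setD1 eqxx.
have [TQ [h hT]] := face_functional (phi_face _ Ts).
have [T'Q _] := face_functional (phi_face _ T's).
have zQ : Q z by exact: T'Q.
have zA : ~~ (lift_pt z <= A)%MS.
  apply/negP => /submxP[D zD]; apply/Tz/hT => //.
  rewrite zD -mulmxA (_ : A *m h = 0) ?mulmx0 ?mxE//; apply/row_matrixP => j.
  have [x [a [Tx Aj]]] := AT j; rewrite row_mul Aj -scalemxAl row0.
  have /hT hx := Tx; have {}hx := hx (TQ _ Tx).
  by apply/matrixP => ? ?; rewrite !ord1 mxE hx mulr0 mxE.
have Tcard : #|T| = #|T :\ i|.+1 by rewrite (cardsD1 i T) iT.
have T'n : (#|T :\ i| < n)%N by rewrite -Tcard.
apply: leq_trans (IHn _ _ (col_mx A (lift_pt z)) T'n T's _); last first.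
  move=> j; rewrite -(splitK j); case: (split j) => l /=; last first.
    by rewrite rowKd; exists z, 1; rewrite scale1r ord1 row_id.
  have [x [a [Tx Al]]] := AT l; rewrite rowKu; exists x, a; split=> //.
  by apply: (phi_sub _ _ T's Ts).2 Tx; exact: subD1set.
rewrite Tcard addnS -addSn leq_add2r -addsmxE; apply: rank_ltmx.
by rewrite /ltmx addsmxSl addsmx_sub submx_refl.
Qed.

(** The rank bound is 1 here, and proportional lifts are equal because both end with 1. *)
Lemma dual_vertexP (S : {set 'I_k}) : gale d S ->
  exists x, vertex Q x /\ phi S = [set x]%classic.
Proof.
move=> gS; have Ss := gale_simplex_face gS; have [phi_face phi_n0 _] := phiP.
have [x Sx] := phi_n0 _ Ss; suff xE : phi S = [set x]%classic.
  by exists x; split => //; rewrite /vertex -xE; exact: phi_face.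
rewrite eqEsubset; split => [y Sy|y ->]//.
have : (\rank (col_mx (lift_pt x) (lift_pt y)) <= 1)%N.
  rewrite -(leq_add2r #|S|); apply: leq_trans (face_rank Ss _) _.
    move=> j; rewrite -(splitK j); case: (split j) => l /=.
      by rewrite rowKu; exists x, 1; rewrite scale1r ord1 row_id.
    by rewrite rowKd; exists y, 1; rewrite scale1r ord1 row_id.
  by have /andP[/eqP -> _] := gS; rewrite addnC.
rewrite -addsmxE => r1; have : (lift_pt x + lift_pt y <= lift_pt x)%MS.
  have := mxrank_leqif_sup (addsmxSl (lift_pt x) (lift_pt y)).
  by move=> [_ <-]; rewrite eqn_leq mxrankS ?addsmxSl// rank_rV lift_pt_neq0.
rewrite addsmx_sub => /andP[_ /sub_rVP[a]].
rewrite /lift_pt scale_row_mx => /eq_row_mx[-> /matrixP/(_ 0 0)].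
by rewrite !mxE eqxx mulr1 => <-; rewrite scale1r.
Qed.

End DualFaces.

(** * The Lorentz form of a sphere *)

Section LorentzForm.
Variables (R : realType) (d : nat) (c : 'rV[R]_d) (r : R).

Let last_coord (X : 'rV[R]_(d + 1)) : R := rsubmx X 0 0.
Let center (X : 'rV[R]_(d + 1)) : 'rV[R]_d := lsubmx X - last_coord X *: c.

(* The quadric of isotropic vectors of this form is the cone over the sphere. *)
Definition lorentz X Y : R :=
  r ^+ 2 * last_coord X * last_coord Y - dotv (center X) (center Y).

Lemma lorentz_sym X Y : lorentz X Y = lorentz Y X.
Proof. by rewrite /lorentz dotvC mulrAC. Qed.

Lemma lorentz_add X Y Z : lorentz (X + Y) Z = lorentz X Z + lorentz Y Z.
Proof.
have -> : lorentz (X + Y) Z = r ^+ 2 * (last_coord X + last_coord Y) * last_coord Z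
    - dotv (center X + center Y) (center Z).
  rewrite /lorentz /center {1}/last_coord linearD mxE; congr (_ - dotv _ _).
  by rewrite linearD /last_coord linearD mxE scalerDl opprD addrACA.
by rewrite dotvDl /lorentz; ring.
Qed.

Lemma lorentz_scale a X Y : lorentz (a *: X) Y = a * lorentz X Y.
Proof.
have -> : lorentz (a *: X) Y = r ^+ 2 * (a * last_coord X) * last_coord Y
    - dotv (a *: center X) (center Y).
  rewrite /lorentz /center {1}/last_coord linearZ mxE; congr (_ - dotv _ _).
  by apply/rowP => j; rewrite /last_coord !mxE; ring.
by rewrite dotvZl /lorentz; ring.
Qed.

Lemma lorentz_lift x y :
  lorentz (lift_pt x) (lift_pt y) = r ^+ 2 - dotv (x - c) (y - c).
Proof.
by rewrite /lorentz /center /last_coord /lift_pt !row_mxKl !row_mxKr !mxE eqxx !scale1r !mulr1.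
Qed.

Lemma lorentz_sphere x : sphere c r x -> lorentz (lift_pt x) (lift_pt x) = 0.
Proof. by rewrite lorentz_lift /sphere /= => ->; rewrite subrr. Qed.

(** Between points of the sphere the form is half the squared distance. *)
Lemma lorentz_sphere_eq0 x y : sphere c r x -> sphere c r y ->
  (lorentz (lift_pt x) (lift_pt y) == 0) = (x == y).
Proof.
rewrite /sphere /= => xc yc; apply/idP/eqP => [|<-]; last by rewrite lorentz_sphere.
rewrite lorentz_lift subr_eq0 => /eqP xy; apply/eqP; rewrite -subr_eq0 -dotvv_eq0.
have -> : x - y = (x - c) - (y - c) by rewrite opprB addrA subrK.
move: (x - c) (y - c) xy xc yc => a b ab aa bb.
by rewrite dotvBl !dotvBr (dotvC b) -ab aa bb !subrr.
Qed.

End LorentzForm.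

(** * Vertices of an inscribed dual as null vectors *)

Section InscribedDual.
Variables (R : realType) (d k : nat) (Q : set 'rV[R]_d) (c : 'rV[R]_d) (r : R).
Variables (phi : {set 'I_k} -> set 'rV[R]_d) (x : {set 'I_k} -> 'rV[R]_d).
Hypothesis phiP : dual_faces Q phi.
Hypothesis xP : forall S, gale d S -> sphere c r (x S) /\ phi S = [set x S]%classic.

Lemma in_dual_face S T : gale d S -> simplex_face d T -> phi T (x S) <-> T \subset S.
Proof.
move=> gS Ts; have [_ _ phi_sub] := phiP; have [_ Sx] := xP gS.
rewrite -(phi_sub _ _ Ts (gale_simplex_face gS)) Sx.
by split => [Tx y ->|]; [|apply].
Qed.

Lemma dual_vertex_inj S S' : gale d S -> gale d S' -> x S = x S' -> S = S'.
Proof.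
move=> gS gS' xx; apply/eqP; rewrite eqEcard.
have [/andP[/eqP -> _] /andP[/eqP -> _]] := (gS, gS'); rewrite leqnn andbT.
by apply/(in_dual_face gS' (gale_simplex_face gS)); rewrite -xx; have [_ ->] := xP gS.
Qed.

Variable S0 : {set 'I_k}.
Hypothesis gS0 : gale d S0.
Local Notation B := (lorentz c r).

Definition normalizer S := if S == S0 then 1 else (B (lift_pt (x S0)) (lift_pt (x S)))^-1.
Definition normalized_vertex S : 'rV[R]_(d + 1) := normalizer S *: lift_pt (x S).
Local Notation X := normalized_vertex.

Lemma normalizer_neq0 S : gale d S -> normalizer S != 0.
Proof.
move=> gS; rewrite /normalizer; case: (eqVneq S S0) => [_|SS0]; first exact: oner_neq0.
have [[xS _] [xS0 _]] := (xP gS, xP gS0).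
rewrite invr_eq0 lorentz_sphere_eq0//.
by apply: contra_neq SS0 => /(dual_vertex_inj gS0 gS).
Qed.

Lemma lorentz_normalized S : gale d S -> B (X S) (X S) = 0.
Proof.
move=> gS; have [xS _] := xP gS.
by rewrite lorentz_scale lorentz_sym lorentz_scale lorentz_sphere// !mulr0.
Qed.

Lemma normalized_vertex_null S : gale d S -> S != S0 -> normal_null B (X S0) (X S).
Proof.
move=> gS SS0; split; first exact: lorentz_normalized.
have := normalizer_neq0 gS; rewrite /normalized_vertex /normalizer eqxx (negPf SS0) invr_eq0 => B0.
by rewrite scale1r [LHS]lorentz_sym lorentz_scale [X in _ * X]lorentz_sym mulVf.
Qed.

Lemma lorentz_normalized_eq0 S S' : gale d S -> gale d S' ->
  B (X S) (X S') = 0 -> S = S'.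
Proof.
move=> gS gS' /eqP; have [[xS _] [xS' _]] := (xP gS, xP gS').
rewrite lorentz_scale lorentz_sym lorentz_scale lorentz_sym mulrA mulf_eq0.
rewrite mulf_eq0 !(negPf (normalizer_neq0 _))//= lorentz_sphere_eq0// => /eqP.
exact: dual_vertex_inj.
Qed.

Lemma normalized_vertex_inj S S' : gale d S -> gale d S' -> S != S' -> X S != X S'.
Proof.
move=> gS gS'; apply: contra_neq => XX; apply: lorentz_normalized_eq0 => //.
by rewrite -XX lorentz_normalized.
Qed.

(** A face with [d - 2] labels has dimension at most 2, so lifted points on it have rank at most
    3. *)
Lemma coplanar_vertices (T S1 S2 S3 S4 : {set 'I_k}) : (#|T| + 2 = d)%N ->
  {in [:: S1; S2; S3; S4], forall S, gale d S && (T \subset S)} ->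
  ~ free4 (X S1) (X S2) (X S3) (X S4).
Proof.
move=> Td TS f.
have S_in i : (i < 4)%N -> nth S1 [:: S1; S2; S3; S4] i \in [:: S1; S2; S3; S4].
  by move=> i4; rewrite mem_nth.
have Ts : simplex_face d T.
  apply/existsP; exists S1; apply: TS; exact: mem_head.
pose A := \matrix_(i < 4) X (nth S1 [:: S1; S2; S3; S4] i).
have := @face_rank R d k Q phi phiP T 4 A Ts.
have -> : \rank A = 4%N.
  apply/eqP/inj_row_free => a aA.
  have := f (a 0 (inord 0)) (a 0 (inord 1)) (a 0 (inord 2)) (a 0 (inord 3)).
  case.
    rewrite -aA mulmx_sum_row !big_ord_recl big_ord0 addr0 !addrA !rowK /=.
    by congr (_ *: _ + _ *: _ + _ *: _ + _ *: _); congr (a 0 _); apply/val_inj;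
      rewrite /= inordK.
  move=> a0 a1 a2 a3; apply/rowP => i; rewrite mxE.
  rewrite -(inord_val i); case: i => [[|[|[|[|]]]]] //=.
have h : (4 + #|T| <= d + 1)%N -> False by lia.
move=> /(_ _)/h; apply => i; have /andP[gS TSi] := TS _ (S_in i (ltn_ord i)).
exists (x (nth S1 [:: S1; S2; S3; S4] i)), (normalizer (nth S1 [:: S1; S2; S3; S4] i)).
by rewrite rowK; split => //; apply/in_dual_face.
Qed.

(** The faces of [S1], [T2] and [T3] form a flag that takes in the four vertices successively; the
    functionals cutting out [T3], [T2] and [S1] make the coefficients vanish from the last one
    on. *)
Lemma affinely_free_vertices (T2 T3 S1 S2 S3 S4 : {set 'I_k}) :
  gale d S1 -> gale d S2 -> gale d S3 -> gale d S4 -> S1 != S2 ->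
  T2 \subset S1 -> T2 \subset S2 -> ~~ (T2 \subset S3) ->
  T3 \subset S1 -> T3 \subset S2 -> T3 \subset S3 -> ~~ (T3 \subset S4) ->
  free4 (X S1) (X S2) (X S3) (X S4).
Proof.
move=> g1 g2 g3 g4 S12 T21 T22 T23 T31 T32 T33 T34 a b e f abef.
have [phi_face _ _] := phiP.
have [s1 s2 s3] : [/\ simplex_face d S1, simplex_face d T2 & simplex_face d T3].
  by split; [| apply: simplex_face_sub T21 _ | apply: simplex_face_sub T31 _];
    exact: (gale_simplex_face g1).
have XQ S : gale d S -> Q (x S).
  move=> gS; have gSs := gale_simplex_face gS.
  apply: (face_functional (phi_face _ gSs)).1.
  by apply/(in_dual_face gS gSs); exact: fintype.subxx.
have func T : simplex_face d T -> exists h : 'cV[R]_(d + 1),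
    (forall S, gale d S -> (X S *m h == 0) = (T \subset S)).
  move=> Ts; have [_ [h hT]] := face_functional (phi_face _ Ts); exists h => S gS.
  rewrite -scalemxAl scaler_eq0 (negPf (normalizer_neq0 gS)) /=.
  apply/eqP/idP => [h0|TS].
    by apply/(in_dual_face gS Ts)/(hT _ (XQ _ gS)); rewrite h0 mxE.
  apply/matrixP => i j; rewrite !ord1 [RHS]mxE; apply/(hT _ (XQ _ gS)).
  exact/(in_dual_face gS Ts).
have apply_h (h : 'cV[R]_(d + 1)) :
    a *: (X S1 *m h) + b *: (X S2 *m h) + e *: (X S3 *m h) + f *: (X S4 *m h) = 0.
  by rewrite !scalemxAl -!mulmxDl abef mul0mx.
have [h3 h3P] := func _ s3; have := apply_h h3.
have [/eqP -> /eqP -> /eqP ->] : [/\ X S1 *m h3 == 0, X S2 *m h3 == 0 & X S3 *m h3 == 0].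
  by rewrite !h3P.
rewrite !scaler0 !add0r => /eqP; rewrite scaler_eq0 h3P// (negPf T34) orbF => /eqP f0.
have [h2 h2P] := func _ s2; have := apply_h h2.
have [/eqP -> /eqP ->] : X S1 *m h2 == 0 /\ X S2 *m h2 == 0 by rewrite !h2P.
rewrite f0 !scaler0 scale0r !add0r addr0 => /eqP.
rewrite scaler_eq0 h2P// (negPf T23) orbF => /eqP e0.
have [h1 h1P] := func _ s1; have := apply_h h1.
have /eqP -> : X S1 *m h1 == 0 by rewrite h1P.
rewrite f0 e0 scaler0 !scale0r add0r !addr0 => /eqP; rewrite scaler_eq0 h1P//.
have -> : S1 \subset S2 = false.
  apply: contraNF S12 => sub12; rewrite eqEcard sub12.
  by have [/andP[/eqP -> _] /andP[/eqP -> _]] := (g1, g2); rewrite leqnn.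
rewrite orbF => /eqP b0; move: abef; rewrite f0 e0 b0 !scale0r !addr0 => /eqP.
rewrite scaler_eq0 => /orP[/eqP ->//|].
by rewrite scaler_eq0 (negPf (normalizer_neq0 g1)) (negPf (lift_pt_neq0 _)).
Qed.

End InscribedDual.

(** * Gale sets with a common block of labels *)

Lemma card_ord_seq k (l : seq nat) : uniq l -> all (fun q => q < k)%N l ->
  #|[set x : 'I_k | (x : nat) \in l]%SET| = size l.
Proof.
move=> l_uniq /all_filterP lk; rewrite -[in RHS]lk size_filter -(size_pmap_sub 'I_k).
rewrite -(card_uniqP (pmap_sub_uniq 'I_k l_uniq)); apply: eq_card => x.
by rewrite finset.in_set mem_pmap_sub.
Qed.

Section GaleFamily.
Variables (d k m : nat).
Hypothesis d_ge4 : (4 <= d)%N.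
Hypothesis mk : (m + (d - 4))%N = k.

(* The last [d - 4] labels belong to every facet below; they cut out of the dual
   a face that is the dual of the cyclic 4-polytope with [m] vertices. *)
Definition padded (l : seq nat) : {set 'I_k} :=
  [set x : 'I_k | (x : nat) \in l ++ iota m (d - 4)]%SET.

Lemma padded_sub l l' : all (fun q => q < m)%N l ->
  (padded l \subset padded l') = all (mem l') l.
Proof.
move=> /allP lm; apply/fintype.subsetP/allP => [sub q ql|sub x].
  have qm := lm q ql; have qk : (q < k)%N by lia.
  have := sub (Ordinal qk); rewrite !finset.in_set !mem_cat /= ql mem_iota.
  by move/(_ isT)/orP => [//|]; lia.
rewrite !finset.in_set !mem_cat => /orP[xl|->]; last by rewrite orbT.
by apply/orP; left; exact: sub.
Qed.

Lemma card_padded l : uniq l -> all (fun q => q < m)%N l ->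
  #|padded l| = (size l + (d - 4))%N.
Proof.
move=> l_uniq lm; rewrite card_ord_seq ?size_cat ?size_iota//.
  rewrite cat_uniq l_uniq iota_uniq andbT /=; apply/hasPn => q; rewrite mem_iota => qm.
  by apply/negP => /(allP lm); lia.
rewrite all_cat; apply/andP; split.
  by apply: sub_all lm => q; lia.
by apply/allP => q; rewrite mem_iota; lia.
Qed.

Lemma card_padded_between l (i j : nat) :
  uniq l -> all (fun q => q < m)%N l -> (j < m)%N ->
  #|[set s in padded l | (i < s < j)%N]%SET| = count (fun q => i < q < j)%N l.
Proof.
move=> l_uniq lm jm; rewrite -size_filter -(@card_ord_seq k) ?filter_uniq//; last first.
  apply/allP => q; rewrite mem_filter => /andP[/andP[_ qj] _].
  by rewrite (ltn_trans qj)// -mk ltn_addr.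
apply: eq_card => s; rewrite !finset.in_set mem_filter mem_cat mem_iota [RHS]andbC.
apply: andb_id2r => /andP[_ sj].
by rewrite (leqNgt m s) (ltn_trans sj jm) orbF.
Qed.

(** All labels from [m] on belong to the set, so the two outside labels are below [m]. They never
    separate an adjacent pair, and in the second shape neither 0 nor [m.-1] lies between them. *)
Lemma gale_padded a b c e : (a < b < c)%N -> (c < e < m)%N ->
  (b == a.+1) && (e == c.+1) || [&& a == 0, c == b.+1 & e == m.-1]%N ->
  gale d (padded [:: a; b; c; e]).
Proof.
move=> abc cem shape.
have l_uniq : uniq [:: a; b; c; e] by rewrite /= !inE; clear -abc cem; lia.
have lm : all (fun q => q < m)%N [:: a; b; c; e] by rewrite /=; clear -abc cem; lia.
apply/andP; split; first by rewrite card_padded//= subnKC.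
apply/forallP => i; apply/forallP => j; apply/implyP => /and3P[].
rewrite !finset.in_set !mem_cat !mem_iota mk !ltn_ord !andbT !negb_or -!ltnNge.
move=> /andP[iS im] /andP[jS jm] ij; rewrite card_padded_between//=.
move: (nat_of_ord i) (nat_of_ord j) iS im jS jm ij => {}i {}j.
clear -abc cem shape.
case/orP: shape => [/andP[/eqP -> /eqP ->]|/and3P[/eqP -> /eqP -> /eqP ->]] iS im jS jm ij.
  have -> : (i < a.+1 < j)%N = (i < a < j)%N by lia.
  have -> : (i < c.+1 < j)%N = (i < c < j)%N by lia.
  by case: (i < a < j)%N; case: (i < c < j)%N.
have -> : (i < m.-1 < j)%N = false by lia.
have -> : (i < b.+1 < j)%N = (i < b < j)%N by lia.
by case: (i < b < j)%N.
Qed.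

End GaleFamily.

Ltac check_labels n_ge3 :=
  first [ by rewrite /= !inE !eqxx ?orbT
        | repeat match goal with
            | l := _ : seq nat |- _ => subst l
            | m := _ : nat |- _ => subst m
          end; by rewrite /= ?inE ?eqxx ?orbT //=; clear -n_ge3; lia ].

(** * The contradiction on a grid of vertices *)

Section NotInscribed.
Variables (R : realType) (d k : nat) (Q : set 'rV[R]_d).
Variable phi : {set 'I_k} -> set 'rV[R]_d.
Hypothesis phiP : dual_faces Q phi.
Hypothesis d_ge4 : (4 <= d)%N.
Hypothesis k_ge : (d + 4 <= k)%N.

Lemma dual_faces_not_inscribed : ~ inscribed Q.
Proof.
move=> [_ [c [r [_ Qcr]]]].
have /choice[x xP] (S : {set 'I_k}) : exists x : 'rV[R]_d,
    gale d S -> sphere c r x /\ phi S = [set x]%classic.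
  have [gS|] := boolP (gale d S); last by exists 0.
  by have [x [vx Sx]] := dual_vertexP phiP gS; exists x; split => //; exact: Qcr.
(* [n + 5] labels remain once [d - 4] are fixed. The bound [n >= 3] is [k >= d + 4]; it keeps the
   labels 0 to 3 apart from [n + 1] to [n + 4]. *)
have [n n_ge3 mk] : exists2 n, (3 <= n)%N & (n.+1.+4 + (d - 4))%N = k.
  by exists (k - (d - 4) - 5)%N; lia.
(* With [i = 1] and [j = n + 2]: the facets [a, a+1, b, b+1] with [|a - i| <= 1]
   and [|b - j| <= 1] form a grid around [v], the [w]'s complete the 2-face of
   the facets [i, i+1], the [x]'s that of the facets [j, j+1]. *)
pose m := n.+1.+4; pose S := padded d k m.
pose v := [:: 1; 2; n.+2; n.+3]%N.
pose y := [:: 1; 2; n.+1; n.+2]%N; pose t := [:: 1; 2; n.+3; n.+4]%N.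
pose Y := [:: 0; 1; n.+2; n.+3]%N; pose T := [:: 2; 3; n.+2; n.+3]%N.
pose p1 := [:: 0; 1; n.+1; n.+2]%N; pose p2 := [:: 0; 1; n.+3; n.+4]%N.
pose p3 := [:: 2; 3; n.+1; n.+2]%N; pose p4 := [:: 2; 3; n.+3; n.+4]%N.
pose w1 := [:: 0; 1; 2; n.+4]%N; pose w2 := [:: 0; 1; 2; 3]%N.
pose w3 := [:: 1; 2; 3; 4]%N; pose x1 := [:: n; n.+1; n.+2; n.+3]%N.
pose x2 := [:: n.+1; n.+2; n.+3; n.+4]%N; pose x3 := [:: 0; n.+2; n.+3; n.+4]%N.
pose L := [:: y; t; Y; T; p1; p2; p3; p4; w1; w2; w3; x1; x2; x3].
have gL l : l \in v :: L -> gale d (S l).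
  suff /allP gL : all (fun l => gale d (S l)) (v :: L) by exact: gL.
  have gS a b e f : [&& a < b, b < e, e < f & f < m]%N ->
      (b == a.+1) && (f == e.+1) || [&& a == 0, e == b.+1 & f == m.-1]%N ->
      gale d (S [:: a; b; e; f]).
    by move=> /and4P[ab be ef fm]; apply: gale_padded => //; apply/andP.
  by rewrite /= !gS ?eqxx ?orbT //= /m; clear -n_ge3; lia.
have Lm l : l \in v :: L -> all (fun q => q < m)%N l.
  suff /allP : all (all (fun q => q < m)%N) (v :: L) by apply.
  by rewrite /= /m; clear -n_ge3; lia.
have sub l l' : all (fun q => q < m)%N l -> (S l \subset S l') = all (mem l') l.
  by move=> lm; apply: (padded_sub d_ge4 mk).
have gv : gale d (S v) by apply/gL/mem_head.
pose X l := normalized_vertex c r x (S v) (S l).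
have neqS l l' : l \in v :: L -> ~~ all (mem l') l -> S l != S l'.
  by move=> lL; rewrite -(sub _ _ (Lm _ lL)); apply: contraNneq => ->; rewrite fintype.subxx.
have neqX l l' : l \in v :: L -> l' \in v :: L -> ~~ all (mem l') l -> X l != X l'.
  by move=> lL l'L nl; apply: (normalized_vertex_inj phiP xP gv) (neqS _ _ lL nl); exact: gL.
have cop a b l1 l2 l3 l4 : (a < b < m)%N ->
    all (mem (v :: L)) [:: l1; l2; l3; l4] ->
    all (fun l => (a \in l) && (b \in l)) [:: l1; l2; l3; l4] ->
    ~ free4 (X l1) (X l2) (X l3) (X l4).
  move=> abm /allP lL /allP abl; apply: (coplanar_vertices phiP xP gv (T := S [:: a; b])).
    by rewrite (card_padded d_ge4 mk)//= ?inE; clear -abm d_ge4; lia.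
  have abm' : all (fun q => q < m)%N [:: a; b] by rewrite /=; clear -abm; lia.
  move=> _ /(mapP (s := [:: l1; l2; l3; l4]))[l l_in ->].
  by rewrite (gL _ (lL _ l_in)) sub//=; have /andP[-> ->] := abl l l_in.
have fr T2 T3 l1 l2 l3 l4 :
    all (mem (v :: L)) [:: l1; l2; l3; l4] ->
    all (fun q => q < m)%N T2 && all (fun q => q < m)%N T3 ->
    [&& ~~ all (mem l2) l1, all (mem l1) T2, all (mem l2) T2 & ~~ all (mem l3) T2] ->
    [&& all (mem l1) T3, all (mem l2) T3, all (mem l3) T3 & ~~ all (mem l4) T3] ->
    free4 (X l1) (X l2) (X l3) (X l4).
  move=> /and5P[i1 i2 i3 i4 _] /andP[m2 m3] /and4P[n12 t21 t22 t23] /and4P[t31 t32 t33 t34].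
  apply: (affinely_free_vertices phiP xP gv (T2 := S T2) (T3 := S T3));
    rewrite ?sub ?neqS//; exact: gL.
suff : lorentz c r (X w2) (X x2) = 0.
  have [i1 i2] : w2 \in v :: L /\ x2 \in v :: L by split; check_labels n_ge3.
  move/(lorentz_normalized_eq0 phiP xP gv (gL _ i1) (gL _ i2))/eqP.
  by apply/negP/neqS => //; check_labels n_ge3.
have vv : lorentz c r (X v) (X v) = 0 by exact: (lorentz_normalized xP (S v) gv).
apply: (@miquel_obstruction _ _ _ (@lorentz_sym _ _ c r) (@lorentz_add _ _ c r)
  (@lorentz_scale _ _ c r) (X v) vv (X y) (X t) (X Y) (X T) (X p1) (X p2) (X p3) (X p4)
  (X w1) (X w2) (X w3) (X x1) (X x2) (X x3)).
- move=> _ /(mapP (s := L))[l lL ->]; apply: (normalized_vertex_null phiP xP gv).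
    by apply: gL; rewrite in_cons lL orbT.
  apply: neqS; first by rewrite in_cons lL orbT.
  suff /allP : all (fun l => ~~ all (mem v) l) L by apply.
  check_labels n_ge3.
(* The flag consists of [v], the edge from [v] to [y], and the polygon of the labels 1 and 2, which
   contains [t] but neither [Y] nor [T]. *)
- apply: (fr [:: 1; 2; n.+2]%N [:: 1; 2]%N); check_labels n_ge3.
- apply: (fr [:: 1; 2; n.+2]%N [:: 1; 2]%N); check_labels n_ge3.
- apply: (fr [:: 1; n.+2; n.+3]%N [:: n.+2; n.+3]%N); check_labels n_ge3.
- apply: (fr [:: 1; n.+2; n.+3]%N [:: n.+2; n.+3]%N); check_labels n_ge3.
- move=> _ /(mapP (s := [:: w1; w2; w3]))[l l_in ->].
  move: l_in; rewrite !inE => /or3P[]/eqP ->;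
  apply: (cop 1%N 2%N); check_labels n_ge3.
- move=> _ /(mapP (s := [:: x1; x2; x3]))[l l_in ->].
  move: l_in; rewrite !inE => /or3P[]/eqP ->;
  apply: (cop n.+2%N n.+3%N); check_labels n_ge3.
(* The four quadrilaterals at [v]. *)
- apply: (cop 1%N n.+2%N); check_labels n_ge3.
- apply: (cop 1%N n.+3%N); check_labels n_ge3.
- apply: (cop 2%N n.+2%N); check_labels n_ge3.
- apply: (cop 2%N n.+3%N); check_labels n_ge3.
(* Four polygons that miss [v], each giving powers at two vertices of the tetrahedron. *)
- apply: (cop 0%N 1%N); check_labels n_ge3.
- apply: (cop 0%N 1%N); check_labels n_ge3.
- apply: (cop 2%N 3%N); check_labels n_ge3.
- apply: (cop 2%N 3%N); check_labels n_ge3.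
- apply: (cop n.+1%N n.+2%N); check_labels n_ge3.
- apply: (cop n.+1%N n.+2%N); check_labels n_ge3.
- apply: (cop n.+3%N n.+4%N); check_labels n_ge3.
- apply: (cop n.+3%N n.+4%N); check_labels n_ge3.
- by rewrite !neqX//; check_labels n_ge3.
- by rewrite !neqX//; check_labels n_ge3.
- by rewrite !neqX//; check_labels n_ge3.
Qed.

End NotInscribed.

Local Close Scope ring_scope.

Theorem corollary1p2 (R : realType) (d k : nat) (P : set 'rV[R]_d)
    (d_ge2 : (2 <= d)%N) (k_gtd : (d + 1 <= k)%N)
    (cyclicP : cyclic_polytope k P) :
  ((d <= 3)%N \/ (d = 4 /\ k = 7) \/ (k <= d + 2)%N ->
     inscribable R d (dual_type P)) /\
  ((d + 4 <= k)%N /\ (8 <= d + 4)%N -> ~ inscribable R d (dual_type P)).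
Proof.
have [t t_lt {cyclicP P}->] := sorted_cyclic_polytope cyclicP.
have d_lt_k : (d < k)%N by rewrite -addn1.
split=> [small|[k_ge d_ge4] [Q Qins /(dual_facesP t_lt d_lt_k)[phi phiP]]]; last first.
  by apply: (dual_faces_not_inscribed phiP) Qins; lia.
have [kd|kd] := leqP k (d + 2).
  have [kd1|kd2] : k = d.+1 \/ k = d.+2 by lia.
    by apply: inscribable_dual_simplex => //; lia.
  by apply: inscribable_dual_two_simplices => //; lia.
have [d2|d3|[d4 k7]] : [\/ d = 2, d = 3 | d = 4 /\ k = 7].
  case: small => [d3|[[-> ->]|]]; last by lia.
    have [->|->] : d = 2 \/ d = 3 by lia.
      by constructor 1.
    by constructor 2.
  by constructor 3.
- by subst d; exact: inscribable_dual_polygon.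
- by subst d; exact: inscribable_dual_wedge.
- by subst d k; exact: inscribable_dual_cyclic47.
Qed.
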